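(* There are absolute constants $C$ and $c$ for which the following holds. If $D$ is a convex symmetric body in $\mathbb{R}^n$ for which $\mathrm{vr}(D)\ge A^{-1}\sqrt{n}$, then there exists a projection $P$ of rank $k\ge c\,n/\log A$ such that $$d(PD, B_\infty^k)\le CA .$$
   Context: For a convex body $D\subset\mathbb{R}^n$ the volume ratio is $\mathrm{vr}(D)=\inf\left(|D|/|\mathcal{E}|\right)^{1/n}$, where $|\cdot|$ is the volume in $\mathbb{R}^n$ and the infimum is over all ellipsoids $\mathcal{E}$ contained in $D$. Symmetric means symmetric about the origin. $B_\infty^k=[-1,1]^k$ is the cube, i.e. the unit ball of $\ell_\infty^k$. $d(\cdot,\cdot)$ is the Banach–Mazur distance between symmetric convex bodies of the same dimension: $d(K,L)=\inf\{ab : a,b>0,\ a^{-1}L\subset TK\subset bL \text{ for some linear isomorphism } T\}$; here $PD$ is regarded as a symmetric convex body in the $k$-dimensional space $P(\mathbb{R}^n)$.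
   Formalization: In dimension n = 1 it is additionally assumed that A ≥ 2: there every body has vr(D) = 1, so the claim fails as A decreases to 1, since c n/log A then exceeds the maximal rank 1; for n ≥ 2 nothing is added. *)

(* Defs.v *)
From HB Require Import structures.
From mathcomp Require Import all_boot all_order all_algebra.
From mathcomp Require Import all_classical all_reals all_analysis.

Set Implicit Arguments.
Unset Strict Implicit.
Unset Printing Implicit Defensive.

Import Order.TTheory GRing.Theory Num.Theory.
Import numFieldNormedType.Exports.

Local Open Scope classical_set_scope.
Local Open Scope ring_scope.

Section ConvexBodies.
Context {R : realType}.

(* The n-fold product of one-dimensional Lebesgue measure. The successor case
   is the product measure [lebesgue_measure \x volume] unfolded to the integral
   of its sections (Tonelli), along 'rV_n.+1 = 'rV_(1 + n). It is n-dimensional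
   Lebesgue measure on Borel sets; convex bodies and ellipsoids are closed. *)
Fixpoint volume (n : nat) : set 'rV[R]_n -> \bar R :=
  match n with
  | 0 => fun S => (\1_S 0)%:E
  | m.+1 => fun S =>
      (\int[lebesgue_measure]_x
         volume [set y : 'rV[R]_m | S (row_mx (x%:M : 'M[R]_1) y)])%E
  end.

Definition symmetric_convex_body (n : nat) (D : set 'rV[R]_n) : Prop :=
  [/\ convex_set D, compact D, D° !=set0 & forall x, D x -> D (- x)].

Definition euclidean_ball (n : nat) : set 'rV[R]_n :=
  [set x | \sum_(i < n) x ord0 i ^+ 2 <= 1].

(* The centre p is arbitrary: ellipsoids need not be centred at the origin. *)
Definition ellipsoid (n : nat) (E : set 'rV[R]_n) : Prop :=
  exists (p : 'rV[R]_n) (M : 'M[R]_n),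
    M \in unitmx /\ E = [set p + x *m M | x in @euclidean_ball n].

Definition volume_ratio (n : nat) (D : set 'rV[R]_n) : \bar R :=
  ereal_inf [set ((fine (volume D) / fine (volume E)) `^ n%:R^-1)%:E
            | E in [set E : set 'rV[R]_n | ellipsoid E /\ E `<=` D]].

Definition cube (k : nat) : set 'rV[R]_k :=
  [set x | forall i, `|x ord0 i| <= 1].

(* Taken in \bar R, so that it is +oo when no isomorphism T is admissible. *)
Definition banach_mazur (V W : vectType R) (K : set V) (L : set W) : \bar R :=
  ereal_inf [set d | exists (a b : R) (T : 'Hom(V, W)),
    [/\ 0 < a /\ 0 < b,
        lker T = 0%VS /\ limg T = fullv,
        [set a^-1 *: y | y in L] `<=` T @` K,
        T @` K `<=` [set b *: y | y in L]
      & d = (a * b)%:E]].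

(* P D as a subset of the vector space P(R^n) rather than of R^n. *)
Definition projected_body (n : nat) (P : 'End('rV[R]_n)) (D : set 'rV[R]_n) :
    set (subvs_of (limg P)) :=
  [set v | (P @` D) (vsval v)].

End ConvexBodies.

Arguments euclidean_ball R n : clear implicits.
Arguments cube R k : clear implicits.
Arguments projected_body {R n} P D.

(* Main.v *)
Require Import Defs.
From HB Require Import structures.
From mathcomp Require Import all_boot all_order all_algebra.
From mathcomp Require Import all_classical all_reals all_analysis.
From mathcomp Require Import measurable_realfun ring lra zify.

Set Implicit Arguments.
Unset Strict Implicit.
Unset Printing Implicit Defensive.

Import Order.TTheory GRing.Theory Num.Theory.
Import numFieldNormedType.Exports.

Local Open Scope classical_set_scope.
Local Open Scope ring_scope.

(** Write B for the Euclidean unit ball and v_n for its volume.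

    The idea is to find n linear functionals, bounded by 1 on D, whose
    parallelepiped has at most C^n n^(n/2) times the volume of the largest
    ellipsoid in D.  In the coordinates T given by these functionals D becomes a
    subset of the cube [-1,1]^n, and the volume ratio hypothesis says that this
    subset fills a proportion at least (cA)^(-n) of the cube.  A Sauer-Shelah
    argument then produces the projection.

    The functionals come from the Dvoretzky-Rogers argument
    ([dvoretzky_rogers]).  If B is an ellipsoid of almost maximal volume in D and
    u_1, ..., u_m have been chosen in the polar of D, stretch B slightly in the
    directions orthogonal to the u_i and shrink it slightly along their span so
    that its volume grows; the new ellipsoid leaves D, and a functional
    separating a point of it from D has a large component orthogonal to the
    u_i.  Step by step this gives det(U)^2 >= n!/(n(1+e))^n for every e > 0.

    The volume enters through [cube_cover_bound]: if TD is covered by N cubes of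
    half-side s then (103/100)^(n-1) <= N (1.01 s A)^n.  It combines the volume
    ratio hypothesis, the determinant estimate, a lower bound for v_n
    ([ball_volume_ge]) and an upper bound for the volume of a set covered by
    parallelepipeds ([volume_le_cube_cover]).  The last of these is the delicate
    point, since an iterated integral is not visibly invariant under linear
    maps.  Ellipsoids have an explicit volume, by completing squares one
    coordinate at a time ([qform_ball_volume]); a parallelepiped is covered
    almost uniformly many times by small ellipsoids of one fixed shape, and a
    fractional cover bounds the volume ([volume_fractional_cover]).

    The estimate is used twice.  With one cube and s = 1 it shows that A is at
    least 1.004 when n > 1, so that the logarithm of 10A is comparable with ln A.
    With s = 1/q, for q close to 9A, it shows that TD meets at least 8^n cells of
    the grid that cuts the cube into q^n cells.  Splitting the cells by the
    parities of their coordinates and counting shattered patterns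
    ([card_le_shattered_in]) gives a set I of coordinates with q^|I| >= 2^n, hence
    |I| >= c n / ln A, and a centre t such that for every choice of signs TD has a
    point beyond t by 1/q in each coordinate of I, on the side given by the sign
    ([gap_shattering]).  By separation the projection of the convex symmetric set
    TD to these coordinates contains the cube of half-side 1/q
    ([symmetric_orthants_cover_cube]); it is contained in the cube of half-side 1,
    so its distance to the cube is at most q <= 10A. *)

(** * Iterated integrals and fractional covers *)

(** The integral of a nonnegative function is a supremum over the simple
    functions below it, whether or not it is measurable. *)
Lemma le_integral_ge0 {R : realType} (f g : R -> \bar R) :
  (forall x, 0 <= f x)%E -> (forall x, f x <= g x)%E ->
  (\int[lebesgue_measure]_x f x <= \int[lebesgue_measure]_x g x)%E.
Proof.
move=> f0 fg.
have g0 x : (0 <= g x)%E by exact: le_trans (fg x).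
rewrite !ge0_integralTE//; apply: le_ereal_sup => _ [h hf <-].
by exists h => // x; exact: le_trans (hf x) (fg x).
Qed.

Lemma volume_ge0 {R : realType} n (S : set 'rV[R]_n) : (0 <= volume S)%E.
Proof.
elim: n S => [|n IHn] S /=; first by rewrite lee_fin.
by apply: integral_ge0 => x _; exact: IHn.
Qed.

Definition slice {R : realType} {n} (S : set 'rV[R]_n.+1) (x : R) :
    set 'rV[R]_n := [set y | S (row_mx (x%:M : 'M[R]_1) y)].

(** The regularity needed to add up volumes: the volume of sections must be
    measurable at every stage of the iterated integral. *)
Fixpoint sectionally_measurable {R : realType} {n : nat} :
    set 'rV[R]_n -> Prop :=
  match n with
  | 0 => fun=> True
  | m.+1 => fun S =>
      (forall x, sectionally_measurable (slice S x)) /\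
      measurable_fun [set: R] (fun x : R => volume (slice S x))
  end.

Lemma volume_slice {R : realType} n (S : set 'rV[R]_n.+1) :
  volume S = (\int[lebesgue_measure]_x volume (slice S x))%E.
Proof. by []. Qed.

(** Subadditivity of the volume, in fractional form: the weighted indicators of
    the [F i] dominate that of [S], and this passes to sections, so one can
    integrate one coordinate after another, comparing with the sections of [S] by
    [le_integral_ge0]. *)
Lemma volume_fractional_cover {R : realType} n (I : finType) (a : R)
    (S : set 'rV[R]_n) (F : I -> set 'rV[R]_n) :
  0 <= a -> (forall i, sectionally_measurable (F i)) ->
  (forall x, S x -> 1 <= a * \sum_i \1_(F i) x) ->
  (volume S <= a%:E * \sum_i volume (F i))%E.
Proof.
move=> a0; elim: n S F => [|n IHn] S F mF cov.
  rewrite /= sumEFin -EFinM lee_fin indicE.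
  have [/set_mem S0|_] := boolP (0 \in S); first exact: cov.
  by rewrite mulr_ge0// sumr_ge0// => i _; rewrite indicE.
rewrite volume_slice.
have m i : measurable_fun [set: R]
  (fun x : R => volume (slice (F i) x)) by case: (mF i).
apply: le_trans (_ : (\int[lebesgue_measure]_x
   (a%:E * \sum_i volume (slice (F i) x)) <= _)%E).
  apply: le_integral_ge0 => x; first exact: volume_ge0.
  apply: (IHn _ (fun i => slice (F i) x)) => [i|y /= Sxy].
    by have [mFi _] := mF i; exact: mFi.
  exact: (cov _ Sxy).
rewrite ge0_integralZl//; last 2 first.
- exact: emeasurable_sum.
- by move=> x _; rewrite sume_ge0// => i _; exact: volume_ge0.
rewrite ge0_integral_sum//.
by move=> i x _; exact: volume_ge0.
Qed.

(** Lebesgue measure and its rescaled pushforward agree on half-open intervals,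
    hence are equal. *)
Lemma integral_affine {R : realType} (b d : R) (f : R -> \bar R) :
  0 < b -> measurable_fun [set: R] f ->
  (forall x, 0 <= f x)%E ->
  (\int[lebesgue_measure]_x f x =
   b%:E * \int[lebesgue_measure]_x f (d + b * x)%R)%E.
Proof.
move=> b0 mf f0.
pose phi : measurableTypeR R -> measurableTypeR R := fun x => d + b * x.
have mphi : measurable_fun setT phi.
  by apply: measurable_funD => //; exact: measurable_funM.
pose bn : {nonneg R} := NngNum (ltW b0).
pose push := [the {measure set (measurableTypeR R) -> \bar R} of
  measure_function_pushforward__canonical__measure_function_Measure
    lebesgue_measure mphi].
pose mu : {measure set (measurableTypeR R) -> \bar R} := mscale bn push.
have E A : measurable A -> lebesgue_measure A = mu A.
  apply: (@lebesgue_measure_unique R mu) => _ [[x y] _ <-] /=.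
  rewrite /mu /mscale /= /pushforward.
  have -> : phi @^-1` [set` `]x, y]%R] = [set` `](x - d) / b, (y - d) / b]%R].
    apply/seteqP; split=> z /=; rewrite !in_itv /= /phi ltr_pdivrMr//;
      by rewrite ler_pdivlMr// ltrBlDl lerBrDl [z * b]mulrC.
  rewrite !lebesgue_measure_itv /= !lte_fin ltr_pM2r ?invr_gt0// ltrD2r.
  case: ifP => _; last by rewrite mule0.
  by rewrite -!EFinB -EFinM; congr (_%:E); field; rewrite gt_eqF.
transitivity (\int[mu]_x f x)%E.
  by apply: eq_measure_integral => A mA _; exact: E.
rewrite ge0_integral_mscale//; congr (_ * _)%E.
by rewrite ge0_integral_pushforward//.
Qed.

(** * Volume of ellipsoids *)

Lemma tr_mx11 {R : realType} (A : 'M[R]_1) : A^T = A.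
Proof. by rewrite [A]mx11_scalar tr_scalar_mx. Qed.

Definition qform {R : realType} {n} (G : 'M[R]_n) (z : 'rV[R]_n) : R :=
  (z *m G *m z^T) 0 0.

Definition posdef {R : realType} {n} (G : 'M[R]_n) : Prop :=
  G^T = G /\ forall z, z != 0 -> 0 < qform G z.

(** Block elimination of the upper right corner. *)
Lemma det_block_schur {R : realType} m n (A : 'M[R]_m) (B : 'M[R]_(m, n))
    (C : 'M[R]_(n, m)) (D : 'M[R]_n) : D \in unitmx ->
  \det (block_mx A B C D) = \det (A - B *m invmx D *m C) * \det D.
Proof.
move=> Du.
have -> : block_mx A B C D = block_mx 1%:M (B *m invmx D) 0 1%:M *m
    block_mx (A - B *m invmx D *m C) 0 C D.
  rewrite mulmx_block !mul1mx !mul0mx !add0r subrK.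
  by rewrite -mulmxA mulVmx// mulmx1.
by rewrite det_mulmx det_ublock det_lblock !det1 !mul1r.
Qed.

Lemma posdef_unit {R : realType} {n} (G : 'M[R]_n) : posdef G -> G \in unitmx.
Proof.
move=> [_ G0]; rewrite -row_free_unit -kermx_eq0; apply/negPn/negP.
move=> /rowV0Pn[z /sub_kermxP zG z0].
by have := G0 _ z0; rewrite /qform zG mul0mx mxE ltxx.
Qed.

(** Completing the square in the last [n] coordinates.  It describes the
    section of an ellipsoid at a given first coordinate as an ellipsoid of one
    dimension less, with a centre moving linearly along [w]. *)
Lemma qform_split {R : realType} {n} (G : 'M[R]_n.+1) : posdef G ->
  exists (H : 'M[R]_n) (w : 'rV[R]_n) (c : R),
    [/\ posdef H, 0 < c, \det G = c * \det H &
     forall (x : R) (y : 'rV[R]_n), qform G (row_mx (x%:M : 'M[R]_1) y) =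
       qform H (y - x *: w) + c * x ^+ 2].
Proof.
move=> [Gsym G0].
have {}Gsym : (G : 'M[R]_(1 + n))^T = G by [].
have {}G0 (z : 'rV[R]_(1 + n)) : z != 0 -> 0 < qform (G : 'M[R]_(1 + n)) z.
  exact: G0.
move: Gsym G0; rewrite -[G](@submxK R 1 n 1 n).
set a := ulsubmx _; set b := ursubmx _; set b' := dlsubmx _; set H := drsubmx _.
rewrite tr_block_mx => /(@eq_block_mx R 1 n 1 n)[_ _ b'E HsE] G0.
have qE (x : R) (y : 'rV[R]_n) :
    qform (block_mx a b b' H) (row_mx (x%:M : 'M[R]_1) y) =
    x ^+ 2 * a 0 0 + 2 * x * (y *m b^T) 0 0 + qform H y.
  rewrite /qform tr_row_mx mul_row_block mul_row_col mulmxDl mulmxDl.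
  rewrite tr_scalar_mx !mul_scalar_mx !mul_mx_scalar -!scalemxAl.
  rewrite -b'E.
  have -> : b *m y^T = y *m b^T by rewrite -[LHS]tr_mx11 trmx_mul trmxK.
  by rewrite !mxE; ring.
have Hp : posdef H.
  split=> // z z0; have := G0 (row_mx (0%:M : 'M[R]_1) z).
  rewrite qE expr2 !(mul0r, mulr0, add0r); apply.
  apply: contra_neq z0 => /eqP; rewrite -(row_mx0 R 1 1 n).
  by move=> /eqP/eq_row_mx[].
have Hu := posdef_unit Hp.
pose w := - (b *m invmx H).
pose c := (a - b *m invmx H *m b^T) 0 0.
have HiT : (invmx H)^T = invmx H by rewrite trmx_inv HsE.
have E x y : qform (block_mx a b b' H) (row_mx (x%:M : 'M[R]_1) y) =
       qform H (y - x *: w) + c * x ^+ 2.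
  rewrite qE /qform /w scalerN opprK.
  rewrite linearD/= linearZ/= trmx_mul HiT.
  rewrite !(mulmxDl, mulmxDr) -!scalemxAl -!scalemxAr.
  rewrite -!mulmxA mulKVmx// [invmx H *m (H *m _)]mulmxA mulVmx// mul1mx.
  have -> : b *m y^T = y *m b^T by rewrite -[LHS]tr_mx11 trmx_mul trmxK.
  by rewrite /c -mulmxA !mxE; ring.
exists H, w, c; split=> //.
  have := G0 (row_mx (1%:M : 'M[R]_1) w).
  rewrite E scale1r subrr /qform mul0mx mul0mx mxE add0r expr1n mulr1; apply.
  apply/eqP; rewrite -(row_mx0 R 1 1 n) => /eq_row_mx[/matrixP/(_ 0 0)].
  by rewrite !mxE/= => /eqP; rewrite oner_eq0.
by rewrite (@det_block_schur R 1 n _ _ _ _ Hu) det_mx11 /c b'E.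
Qed.

(** The volume of a Euclidean ball of squared radius [s], up to the volume of
    the unit ball.  The test on [s] matters only for [n = 0], where the ball of
    negative squared radius is empty although the power is 1. *)
Definition sqrt_pow {R : realType} (n : nat) (s : R) : R :=
  if 0 <= s then Num.sqrt s ^+ n else 0.

Lemma sqrt_pow_ge0 {R : realType} n (s : R) : 0 <= sqrt_pow n s.
Proof. by rewrite /sqrt_pow; case: ifP => // _; rewrite exprn_ge0// sqrtr_ge0. Qed.

Lemma sqrt_powM {R : realType} n (s t : R) : 0 < s ->
  sqrt_pow n (s * t) = Num.sqrt s ^+ n * sqrt_pow n t.
Proof.
move=> s0; rewrite /sqrt_pow pmulr_rge0//; case: ifP => _; last by rewrite mulr0.
by rewrite sqrtrM ?ltW// exprMn.
Qed.

Lemma measurable_sqrt_pow {R : realType} n (f : R -> R) :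
  measurable_fun [set: R] f -> measurable_fun [set: R] (fun x => sqrt_pow n (f x)).
Proof.
move=> mf; apply: measurable_fun_ifT => //.
  exact: measurable_fun_ler.
apply: measurable_funX; apply: measurableT_comp => //.
exact: (continuous_measurable_fun (@sqrt_continuous R)).
Qed.

(** The ratio of the volumes of the unit balls in dimensions [n.+1] and [n]. *)
Definition cap_integral {R : realType} (n : nat) : R :=
  fine (\int[lebesgue_measure]_x (sqrt_pow n (1 - x ^+ 2 : R))%:E)%E.

Lemma sqrt_pow_cap_le {R : realType} n (x : R) :
  sqrt_pow n (1 - x ^+ 2) <= \1_`[-1, 1] x.
Proof.
rewrite indicE; case: (boolP (x \in _)) => [_|] /=.
  rewrite /sqrt_pow; case: ifP => // h; rewrite exprn_ile1 ?sqrtr_ge0//.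
  by rewrite -[leRHS]sqrtr1 ler_wsqrtr// lerBlDr lerDl sqr_ge0.
move=> /negP nx; rewrite /sqrt_pow ifF//; apply/negP => h; apply: nx.
rewrite inE /= in_itv/= -ler_norml -(@ler_pXn2r _ 2)// ?nnegrE//.
by rewrite expr1n real_normK ?num_real//; lra.
Qed.

Lemma cap_integralE {R : realType} n :
  (\int[lebesgue_measure]_x (sqrt_pow n (1 - x ^+ 2 : R))%:E
    = (@cap_integral R n)%:E)%E.
Proof.
rewrite /cap_integral fineK// ge0_fin_numE; last first.
  by apply: integral_ge0 => x _; rewrite lee_fin sqrt_pow_ge0.
apply: (@le_lt_trans _ _ (\int[lebesgue_measure]_x (\1_`[-1, 1] (x : R))%:E)%E).
  by apply: le_integral_ge0 => x; rewrite lee_fin ?sqrt_pow_ge0 ?sqrt_pow_cap_le.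
rewrite integral_indic//. rewrite setIT /= lebesgue_measure_itv /= lte_fin.
by case: ifP => _; rewrite -?EFinB ltry.
Qed.

Definition ball_volume {R : realType} (n : nat) : R :=
  \prod_(k < n) cap_integral k.

(** The substitution [x = d + sqrt (s / c) * t] when [s > 0].  For [s = 0] the
    integrand vanishes except possibly at the point [d]. *)
Lemma integral_sqrt_pow {R : realType} n (c s d : R) : 0 < c ->
  (\int[lebesgue_measure]_x (sqrt_pow n (s - c * (x - d) ^+ 2))%:E =
   (sqrt_pow n.+1 s / Num.sqrt c * cap_integral n)%:E)%E.
Proof.
move=> c0; have [s0|s0|s0] := ltgtP s 0.
- rewrite /sqrt_pow [0 <= s]leNgt s0/= !mul0r integral0_eq// => x _.
  rewrite ifF//; apply/negbTE; rewrite -ltNge.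
  by rewrite subr_lt0 (lt_le_trans s0)// mulr_ge0 ?sqr_ge0// ltW.
- rewrite (@integral_affine _ (Num.sqrt s / Num.sqrt c) d)//; last 3 first.
  + by rewrite divr_gt0// sqrtr_gt0.
  + apply/measurable_EFinP; apply: measurable_sqrt_pow; apply: measurable_funB => //.
    apply: measurable_funM => //; apply: measurable_funX.
    exact: measurable_funB.
  + by move=> x; rewrite lee_fin sqrt_pow_ge0.
  have E x : sqrt_pow n (s - c * (d + Num.sqrt s / Num.sqrt c * x - d) ^+ 2) =
     Num.sqrt s ^+ n * sqrt_pow n (1 - x ^+ 2).
    rewrite -sqrt_powM//; congr sqrt_pow.
    rewrite [d + _]addrC addrK !exprMn exprVn !sqr_sqrtr ?ltW//.
    by field; rewrite gt_eqF.
  under eq_integral do rewrite E EFinM.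
  rewrite ge0_integralZl//=; last 2 first.
  + apply/measurable_EFinP; apply: measurable_sqrt_pow; apply: measurable_funB => //.
  + by move=> x _; rewrite lee_fin sqrt_pow_ge0.
  rewrite cap_integralE -!EFinM /sqrt_pow ltW//; congr EFin.
  by rewrite exprS; ring.
- rewrite s0 {2}/sqrt_pow lexx sqrtr0 expr0n/= !mul0r.
  apply/eqP; rewrite eq_le; apply/andP; split; last first.
    by apply: integral_ge0 => x _; rewrite lee_fin sqrt_pow_ge0.
  apply: (@le_trans _ _
      (\int[lebesgue_measure]_x (\1_[set d] (x : R))%:E)%E); last first.
    by rewrite integral_indic// setIT /= lebesgue_measure_set1.
  apply: le_integral_ge0 => x; rewrite lee_fin ?sqrt_pow_ge0//.
  have [->|xd] := eqVneq x d.
    rewrite indicE mem_set// subrr expr0n mulr0 subr0 /sqrt_pow lexx sqrtr0.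
    by rewrite expr0n; case: (n).
  rewrite sub0r /sqrt_pow ifF ?indicE//; apply/negbTE; rewrite -ltNge oppr_lt0.
  by rewrite mulr_gt0// exprn_even_gt0//= subr_eq0.
Qed.

Definition qform_ball {R : realType} {n} (G : 'M[R]_n) (p : 'rV[R]_n) (s : R) :
  set 'rV[R]_n := [set z | qform G (z - p) <= s].

Lemma row_mx_subl {R : realType} n (x : R) (y : 'rV[R]_n) (p : 'rV[R]_n.+1) :
  row_mx (x%:M : 'M[R]_1) y - p =
  row_mx ((x - p 0 0)%:M : 'M[R]_1) (y - @rsubmx R 1 1 n p).
Proof.
apply/rowP => j; rewrite !mxE; case: splitP => k jk; rewrite !mxE.
  by rewrite !ord1 !mulr1n; congr (_ - p _ _); apply: val_inj; rewrite /= jk ord1.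
by congr (_ - p _ _); apply: val_inj.
Qed.

(** Ellipsoids given by a quadratic form are stable under sections, and the
    determinant of the form is multiplicative along [qform_split]; hence the
    change of variables formula for ellipsoids, by induction on the dimension and
    without any invariance of the iterated integral under linear maps. *)
Lemma qform_ball_volume {R : realType} n (G : 'M[R]_n) p s : posdef G ->
  sectionally_measurable (qform_ball G p s) /\
  (volume (qform_ball G p s) =
    (sqrt_pow n s * ball_volume n / Num.sqrt (\det G))%:E)%E.
Proof.
elim: n G p s => [|n IHn] G p s Gp.
  split=> //=; congr EFin.
  rewrite indicE /ball_volume big_ord0 det_mx00 sqrtr1 divr1 mulr1 /sqrt_pow.
  have -> : (0 \in qform_ball G p s) = (0 <= s).
    apply/idP/idP; rewrite inE /qform_ball /= /qform.
      by rewrite [_ *m G]thinmx0 mul0mx mxE.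
    by rewrite [_ *m G]thinmx0 mul0mx mxE.
  by case: ifP.
have [H [w [c [Hp c0 Gdet GE]]]] := qform_split Gp.
set p0 := p 0 0; set p1 : 'rV_n := @rsubmx R 1 1 n p.
have sE x : slice (qform_ball G p s) x =
    qform_ball H (p1 + (x - p0) *: w) (s - c * (x - p0) ^+ 2).
  apply/seteqP; split => y; rewrite /slice /qform_ball /=.
    by rewrite row_mx_subl GE opprD addrA lerBrDr.
  by rewrite row_mx_subl GE opprD addrA lerBrDr.
have vE x : (volume (slice (qform_ball G p s) x) =
   (ball_volume n / Num.sqrt (\det H))%:E *
   (sqrt_pow n (s - c * (x - p0) ^+ 2))%:E)%E.
  by rewrite sE (IHn _ _ _ Hp).2 -EFinM; congr EFin; ring.
have ms : measurable_fun [set: R]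
   (fun x : R => (sqrt_pow n (s - c * (x - p0) ^+ 2))%:E).
  apply/measurable_EFinP; apply: measurable_sqrt_pow; apply: measurable_funB => //.
  by apply: measurable_funM => //; apply: measurable_funX; exact: measurable_funB.
split.
  split=> [x|]; first by rewrite sE; exact: (IHn _ _ _ Hp).1.
  under eq_fun do rewrite vE.
  exact: measurable_funeM.
rewrite volume_slice; under eq_integral do rewrite vE.
rewrite ge0_integralZl//; last 2 first.
- by move=> x _; rewrite lee_fin sqrt_pow_ge0.
- rewrite lee_fin divr_ge0 ?sqrtr_ge0// prodr_ge0// => i _.
  by rewrite -lee_fin -cap_integralE integral_ge0// => x _; rewrite lee_fin sqrt_pow_ge0.
rewrite integral_sqrt_pow// -EFinM; congr EFin.
rewrite Gdet sqrtrM ?ltW// /ball_volume big_ord_recr/= invfM; ring.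
Qed.

(** * Lower bounds for the volume of the ball *)

Lemma integral_even_quartic {R : realType} (a b s : R) : 0 < s ->
  (\int[lebesgue_measure]_(x in `[(- s)%R, s]) (1 + a * x ^+ 2 + b * x ^+ 4)%:E =
  (2 * (s + a * s ^+ 3 / 3 + b * s ^+ 5 / 5))%:E)%E.
Proof.
move=> s0.
pose F x : R := x + a / 3 * x ^+ 3 + b / 5 * x ^+ 5.
have dF (x : R) : is_derive x (1 : R) F (1 + a * x ^+ 2 + b * x ^+ 4).
  rewrite /F; apply: is_derive_eq; rewrite /GRing.scale/=; by field.
transitivity ((F s)%:E - (F (- s))%:E)%E; last first.
  by rewrite -EFinB; congr EFin; rewrite /F; field.
apply: continuous_FTC2.
- by rewrite (lt_trans _ s0)// oppr_lt0.
- apply: continuous_subspaceT => x.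
  do 2?[apply: cvgD; [|apply: cvgM; [exact: cvg_cst|exact: exprn_continuous]]].
  exact: cvg_cst.
- split => [x _||].
  + exact: ex_derive.
  + apply: cvg_at_right_filter; apply: differentiable_continuous.
    exact/derivable1_diffP/ex_derive.
  + apply: cvg_at_left_filter; apply: differentiable_continuous.
    exact/derivable1_diffP/ex_derive.
- by move=> x _; rewrite derive1E derive_val.
Qed.

(** Even quartic polynomials are flexible enough to give all the lower bounds
    needed on [cap_integral]. *)
Lemma cap_integral_ge_quartic {R : realType} n (a b s : R) : 0 < s -> s <= 1 ->
  (forall x, x ^+ 2 <= s ^+ 2 -> 0 <= 1 + a * x ^+ 2 + b * x ^+ 4 <=
     Num.sqrt (1 - x ^+ 2) ^+ n) ->
  2 * (s + a * s ^+ 3 / 3 + b * s ^+ 5 / 5) <= cap_integral n.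
Proof.
move=> s0 s1 ab; rewrite -lee_fin -cap_integralE -integral_even_quartic//.
rewrite integral_mkcond.
have H x : x \in `[- s, s] -> x ^+ 2 <= s ^+ 2.
  rewrite in_itv/= -ler_norml => xs.
  by rewrite -real_normK ?num_real// ler_pXn2r ?nnegrE// ltW.
apply: le_integral_ge0 => x; rewrite patchE; case: ifPn => //.
- by rewrite inE/= => /H/ab/andP[? _]; rewrite lee_fin.
- rewrite inE/= => /H xs; rewrite lee_fin /sqrt_pow ifT; first by case/andP: (ab _ xs).
  by rewrite subr_ge0 (le_trans xs)// exprn_ile1// ltW.
- by rewrite lee_fin sqrt_pow_ge0.
Qed.

(** The inequality of the arithmetic and geometric means for [m] numbers, four
    of them equal to [1 - m u / 4] and the others to 1: their mean is [1 - u]. *)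
Lemma quartic_bernoulli {R : realType} (u : R) m : (4 <= m)%N -> 0 <= u ->
  0 <= 1 - m%:R * u / 4 -> (1 - m%:R * u / 4) ^+ 4 <= (1 - u) ^+ m.
Proof.
move=> m4 u0 h.
pose E (i : 'I_4 + 'I_(m - 4)) : R := if i is inl _ then 1 - m%:R * u / 4 else 1.
have E0 : {in predT, forall i, 0 <= E i} by case.
have := (leif_AGM E0).1; rewrite !big_sumType /=.
rewrite !prodr_const !sumr_const expr1n mulr1 !card_ord card_sum !card_ord.
rewrite subnKC// => /le_trans; apply; rewrite le_eqVlt; apply/orP; left; apply/eqP.
congr (_ ^+ _); rewrite natrB//.
have m0 : m%:R != 0 :> R by rewrite pnatr_eq0; case: (m) m4.
by field.
Qed.

Lemma cap_integral0 {R : realType} : @cap_integral R 0 = 2.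
Proof.
apply/eqP; rewrite eq_le; apply/andP; split; last first.
  have := @cap_integral_ge_quartic R 0 0 0 1 ltr01 (lexx _).
  rewrite !mul0r !addr0 mulr1; apply => x _.
  by rewrite !mul0r !addr0 expr0 ler01 lexx.
rewrite -lee_fin -cap_integralE.
apply: (@le_trans _ _ (\int[lebesgue_measure]_x (\1_`[-1, 1] (x : R))%:E)%E).
  by apply: le_integral_ge0 => x; rewrite lee_fin ?sqrt_pow_ge0 ?sqrt_pow_cap_le.
rewrite integral_indic// setIT /= lebesgue_measure_itv /= lte_fin.
by rewrite ifT ?ltrN2 -?EFinB ?lee_fin; lra.
Qed.

(** The exact value behaves like [sqrt (2 pi / n)], and [sqrt (2 pi) > 2]; what
    matters below is that the constant exceeds 2 for every [n > 0].  The cases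
    [n = 1] and [n = 2] are the tightest and use their own minorants of the
    integrand. *)
Lemma cap_integral_ge {R : realType} n : (0 < n)%N ->
  2 * (103 / 100) <= Num.sqrt n.+1%:R * @cap_integral R n.
Proof.
case: n => [//|[|[|n]]] _.
- have I : 2 * (1 + (- (1/2)) * 1 ^+ 3 / 3 + (- (1/2)) * 1 ^+ 5 / 5)
      <= @cap_integral R 1.
    apply: cap_integral_ge_quartic => // x; rewrite !expr1n expr1 => x1.
    have y0 := sqr_ge0 x.
    have -> : x ^+ 4 = (x ^+ 2) ^+ 2 by rewrite -exprM.
    set y := x ^+ 2 in x1 y0 *.
    have p0 : 0 <= 1 + - (1 / 2) * y + - (1 / 2) * y ^+ 2 by nra.
    rewrite p0 /= -(ger0_norm p0) -sqrtr_sqr ler_wsqrtr//.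
    rewrite -subr_ge0.
    have -> : 1 - y - (1 + - (1 / 2) * y + - (1 / 2) * y ^+ 2) ^+ 2 =
      y ^+ 2 * (1 - y) * (3 / 4 + y / 4) by field.
    by apply: mulr_ge0; [apply: mulr_ge0; [exact: sqr_ge0|]|]; lra.
  have s2 : 1414 / 1000 <= Num.sqrt (2%:R : R).
    rewrite -[leLHS]ger0_norm; last by lra.
    by rewrite -sqrtr_sqr ler_wsqrtr// expr2; lra.
  have := ler_pM _ _ s2 I; rewrite !expr1n => /(_ _ _)/le_trans.
  by move=> h; apply: le_trans (h _ _ _ (lexx _)); lra.
- have I : 2 * (1 + (- 1) * 1 ^+ 3 / 3 + 0 * 1 ^+ 5 / 5)
      <= @cap_integral R 2.
    apply: cap_integral_ge_quartic => // x; rewrite !expr1n mul0r addr0 => x1.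
    by rewrite sqr_sqrtr; lra.
  have s3 : 16 / 10 <= Num.sqrt (3%:R : R).
    rewrite -[leLHS]ger0_norm; last by lra.
    by rewrite -sqrtr_sqr ler_wsqrtr// expr2; lra.
  have := ler_pM _ _ s3 I; rewrite !expr1n => /(_ _ _)/le_trans.
  by move=> h; apply: le_trans (h _ _ _ (lexx _)); lra.
(* The quartic minorant of (1 - x^2)^m requires m >= 4, hence N = 3 is enlarged. *)
set N := n.+3; set m := maxn N 4.
have m4 : (4 <= m)%N by rewrite leq_maxr.
have m0 : 0 < m%:R :> R by rewrite ltr0n (leq_trans _ m4).
(* The minorant (1 - m x^2 / 4)^2 is decreasing in |x| exactly up to s. *)
pose s : R := 2 / Num.sqrt m%:R.
have sm : Num.sqrt m%:R ^+ 2 = m%:R :> R by rewrite sqr_sqrtr ?ltW.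
have rm0 : 0 < Num.sqrt m%:R :> R by rewrite sqrtr_gt0.
have s0 : 0 < s by rewrite divr_gt0.
have ss : s ^+ 2 = 4 / m%:R by rewrite expr_div_n sm; lra.
have m4R : 4 <= m%:R :> R by rewrite ler_nat.
have s1 : s <= 1.
  by rewrite -(@expr_le1 _ 2%N) ?(ltW s0)// ss ler_pdivrMr// mul1r.
have I : 2 * (s + (- (m%:R / 2)) * s ^+ 3 / 3 + (m%:R ^+ 2 / 16) * s ^+ 5 / 5)
      <= @cap_integral R N.
  apply: cap_integral_ge_quartic => // x xs.
  have y0 := sqr_ge0 x.
  have -> : x ^+ 4 = (x ^+ 2) ^+ 2 by rewrite -exprM.
  have y1 : x ^+ 2 <= 1 by rewrite (le_trans xs)// exprn_ile1// ltW.
  set y := x ^+ 2 in xs y0 y1 *.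
  have -> : 1 + - (m%:R / 2) * y + m%:R ^+ 2 / 16 * y ^+ 2 =
     (1 - m%:R * y / 4) ^+ 2 by field.
  rewrite sqr_ge0 /=.
  have p0 : 0 <= 1 - m%:R * y / 4.
    move: xs; rewrite ss ler_pdivlMr// => xs; lra.
  have r0 : 0 <= Num.sqrt (1 - y) by rewrite sqrtr_ge0.
  apply: (@le_trans _ _ (Num.sqrt (1 - y) ^+ m)).
    rewrite -(@ler_pXn2r _ 2)// ?nnegrE ?exprn_ge0 ?sqr_ge0//.
    rewrite -!exprM (mulnC m) (exprM (Num.sqrt _)) sqr_sqrtr; last by lra.
    exact: quartic_bernoulli.
  rewrite ler_wiXn2l// ?leq_maxl//.
  by rewrite -[leRHS]sqrtr1 ler_wsqrtr//; lra.
have {}I : 32 / 15 / Num.sqrt m%:R <= @cap_integral R N.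
  apply: le_trans I; rewrite le_eqVlt; apply/orP; left; apply/eqP.
  rewrite !exprS expr0 !mulr1 -/(s ^+ 2).
  have -> : s * (s * s) = s * s ^+ 2 by rewrite expr2.
  have -> : s * (s * (s * (s * s))) = s * (s ^+ 2) ^+ 2 by ring.
  by rewrite ss /s; field; rewrite !gt_eqF.
apply: le_trans (ler_wpM2l (sqrtr_ge0 _) I).
rewrite [leRHS]mulrA ler_pdivlMr//.
have mN : m%:R <= N.+1%:R :> R by rewrite ler_nat geq_max leqnSn.
have := ler_wsqrtr mN; set q := Num.sqrt N.+1%:R; set r := Num.sqrt m%:R in rm0 *.
by move=> ?; lra.
Qed.

Lemma cap_integral_gt0 {R : realType} n : 0 < @cap_integral R n.
Proof.
case: n => [|n]; first by rewrite cap_integral0.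
have := @cap_integral_ge R n.+1 isT; rewrite ltNge => h; apply/negP => h'.
have : Num.sqrt n.+2%:R * @cap_integral R n.+1 <= 0.
  by rewrite mulr_ge0_le0// sqrtr_ge0.
by lra.
Qed.

Lemma ball_volume_gt0 {R : realType} n : 0 < @ball_volume R n.
Proof. by apply: prodr_gt0 => i _; exact: cap_integral_gt0. Qed.

(** The product of the previous bounds.  The case [k = 0] of the product gives
    no gain, hence the exponent [n] instead of [n.+1] on [103 / 100]. *)
Lemma ball_volume_ge {R : realType} n :
  2 ^+ n.+1 * (103 / 100) ^+ n <=
  @ball_volume R n.+1 * Num.sqrt (n.+1)`!%:R.
Proof.
rewrite /ball_volume; elim: n => [|n IHn].
  by rewrite big_ord_recl big_ord0 cap_integral0 sqrtr1 expr0 expr1 !mulr1.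
rewrite big_ord_recr/= factS natrM sqrtrM ?ler0n// [2 ^+ _]exprS [(_ / _) ^+ _]exprS.
have h := @cap_integral_ge R n.+1 isT.
have := ler_pM _ _ IHn h.
rewrite mulr_ge0 ?exprn_ge0 ?mulr_ge0//; lra.
Qed.

(** * Boxes and affine images of the ball *)

Lemma sectionally_measurable0 {R : realType} n :
  sectionally_measurable (set0 : set 'rV[R]_n) /\
  volume (set0 : set 'rV[R]_n) = 0%E.
Proof.
elim: n => [|n [IHm IHv]]; first by rewrite /= indicE in_set0.
have s0 x : slice (set0 : set 'rV[R]_n.+1) x = set0 by [].
split; last first.
  by rewrite volume_slice integral0_eq// => x _; rewrite s0.
split; first by move=> x; rewrite s0.
by under eq_fun do rewrite s0 IHv; exact: measurable_cst.
Qed.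

Definition box {R : realType} {n} (p : 'rV[R]_n) (h : R) : set 'rV[R]_n :=
  [set x | forall i, p 0 i <= x 0 i <= p 0 i + h].

Lemma box_volume {R : realType} n (p : 'rV[R]_n) (h : R) : 0 <= h ->
  sectionally_measurable (box p h) /\ volume (box p h) = (h ^+ n)%:E.
Proof.
move=> h0; elim: n p => [|n IHn] p.
  by split=> //=; rewrite indicE mem_set// => -[].
set I := `[p 0 0, p 0 0 + h].
have sE x : slice (box p h) x =
   if x \in I then box (@rsubmx R 1 1 n p) h else set0.
  apply/seteqP; split => y; rewrite /slice /box /=.
    move=> H; have := H 0; rewrite mxE; case: splitP => // k _.
    rewrite ord1 mxE eqxx mulr1n => Ix; rewrite in_itv/= Ix /= => i.
    have := H (@rshift 1 n i); rewrite !mxE; case: splitP => [k' /=|k'].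
      by move=> /eqP; rewrite ord1.
    by move=> /addnI/val_inj ->.
  case: ifPn => //; rewrite in_itv/= => Ix H i; rewrite mxE; case: splitP => k ik.
    rewrite !ord1 mxE eqxx mulr1n.
    by have -> : i = 0 by apply: val_inj; rewrite /= ik ord1.
  have := H k; rewrite !mxE.
  by have -> : i = @rshift 1 n k by apply: val_inj.
have vE x : volume (slice (box p h) x) = ((h ^+ n)%:E * (\1_[set` I] x)%:E)%E.
  rewrite sE indicE; case: (boolP (x \in I)) => xI.
    by rewrite mem_set// mule1 (IHn _).2.
  by rewrite memNset ?mule0 ?(@sectionally_measurable0 R n).2//; apply/negP.
split.
  split=> [x|].
    rewrite sE; case: ifP => _; first exact: (IHn _).1.
    exact: (@sectionally_measurable0 R n).1.
  under eq_fun do rewrite vE.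
  apply: measurable_funeM; apply/measurable_EFinP.
  exact: measurable_indic.
rewrite volume_slice; under eq_integral do rewrite vE.
rewrite ge0_integralZl//; last 2 first.
- by apply/measurable_EFinP; exact: measurable_indic.
- by rewrite lee_fin exprn_ge0.
rewrite integral_indic// setIT /= lebesgue_measure_itv /= lte_fin ltrDl.
rewrite exprSr EFinM; congr (_ * _)%E; case: ltP => [_|h0'].
  by rewrite -EFinB addrAC subrr add0r.
by congr EFin; apply/eqP; rewrite eq_le h0.
Qed.

Definition sqnorm {R : realType} {n} (x : 'rV[R]_n) : R :=
  \sum_(i < n) x 0 i ^+ 2.

Lemma sqnormE {R : realType} n (x : 'rV[R]_n) : sqnorm x = (x *m x^T) 0 0.
Proof. by rewrite mxE; apply: eq_bigr => i _; rewrite mxE expr2. Qed.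

Lemma sqnorm_ge0 {R : realType} n (x : 'rV[R]_n) : 0 <= sqnorm x.
Proof. by apply: sumr_ge0 => i _; rewrite sqr_ge0. Qed.

Lemma sqnorm_gt0 {R : realType} n (x : 'rV[R]_n) : x != 0 -> 0 < sqnorm x.
Proof.
move=> x0; rewrite lt_def sqnorm_ge0 andbT; apply: contra_neq x0 => /eqP.
rewrite psumr_eq0 => [/allP h|i _]; last exact: sqr_ge0.
apply/rowP => i; have := h i; rewrite mem_index_enum mxE sqrf_eq0 => /(_ isT)/eqP.
by [].
Qed.

Lemma le_sqnorm_coord {R : realType} n (x : 'rV[R]_n) i : x 0 i ^+ 2 <= sqnorm x.
Proof.
by rewrite /sqnorm (bigD1 i)//= lerDl sumr_ge0// => j _; rewrite sqr_ge0.
Qed.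

(** The triangle inequality for the Euclidean norm, without square roots; for
    positive [a] and [b] it follows from weighted sums of squares. *)
Lemma sqnormD_le {R : realType} n (x y : 'rV[R]_n) (a b : R) :
  0 < a -> 0 < b -> sqnorm x <= a ^+ 2 -> sqnorm y <= b ^+ 2 ->
  sqnorm (x + y) <= (a + b) ^+ 2.
Proof.
move=> a0 b0 xa yb.
apply: (@le_trans _ _ ((1 + b / a) * sqnorm x + (1 + a / b) * sqnorm y)).
  rewrite /sqnorm !mulr_sumr -big_split/=; apply: ler_sum => i _; rewrite mxE.
  set u := x 0 i; set v := y 0 i; rewrite -subr_ge0.
  have -> : (1 + b / a) * u ^+ 2 + (1 + a / b) * v ^+ 2 - (u + v) ^+ 2 =
    (b * u - a * v) ^+ 2 / (a * b) by field; rewrite !gt_eqF.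
  by rewrite divr_ge0 ?sqr_ge0// mulr_ge0// ltW.
apply: (@le_trans _ _ ((1 + b / a) * a ^+ 2 + (1 + a / b) * b ^+ 2)).
  by apply: lerD; rewrite ler_wpM2l// addr_ge0// divr_ge0// ltW.
rewrite le_eqVlt; apply/orP; left; apply/eqP; field.
by rewrite !gt_eqF.
Qed.

Lemma qform_gram {R : realType} n m (M : 'M[R]_(n, m)) (z : 'rV[R]_n) :
  qform (M *m M^T) z = sqnorm (z *m M).
Proof. by rewrite /qform sqnormE trmx_mul !mulmxA. Qed.

Lemma gram_posdef {R : realType} n (M : 'M[R]_n) : M \in unitmx ->
  posdef (M *m M^T).
Proof.
move=> Mu; split; first by rewrite trmx_mul trmxK.
move=> z z0; rewrite qform_gram; apply: sqnorm_gt0.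
by apply: contra_neq z0 => zM; rewrite -[z](mulmxK Mu) zM mul0mx.
Qed.

Definition affine_ball {R : realType} {n} (M : 'M[R]_n) (p : 'rV[R]_n) (r : R) :
  set 'rV[R]_n := [set z | sqnorm ((z - p) *m invmx M) <= r ^+ 2].

Lemma affine_ball_volume {R : realType} n (M : 'M[R]_n) p (r : R) :
  M \in unitmx -> 0 <= r ->
  sectionally_measurable (affine_ball M p r) /\
  volume (affine_ball M p r) = (r ^+ n * ball_volume n * `|\det M|)%:E.
Proof.
move=> Mu r0; set G := invmx M *m (invmx M)^T.
have -> : affine_ball M p r = qform_ball G p (r ^+ 2).
  by apply/seteqP; split => z; rewrite /affine_ball /qform_ball /= qform_gram.
have Gp : posdef G by apply: gram_posdef; rewrite unitmx_inv.
have [mE ->] := qform_ball_volume p (r ^+ 2) Gp; split=> //; congr EFin.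
rewrite /sqrt_pow sqr_ge0 sqrtr_sqr ger0_norm//; congr (_ * _).
by rewrite det_mulmx det_tr -expr2 sqrtr_sqr det_inv normrV ?invrK// -unitmxE.
Qed.

(** * Volume of sets covered by parallelepipeds *)

Definition grid_node {R : realType} {n K} (h c : R) (k : {ffun 'I_n -> 'I_K}) :
  'rV[R]_n := \row_i (h * (k i)%:R - c).

(** A Euclidean ball contains about [volume / h ^ n] nodes of a grid of mesh [h]:
    the boxes attached to the nodes in the ball of radius [r] cover the ball of
    radius [r - h sqrt n], because a box has diameter [h sqrt n]. *)
Lemma grid_count {R : realType} n K (h c s r : R) (y : 'rV[R]_n) :
  (0 < n)%N -> 0 < h -> h * Num.sqrt n%:R < r -> c = s + r -> h * K%:R = 2 * c ->
  (forall i, `|y 0 i| <= s) ->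
  (r - h * Num.sqrt n%:R) ^+ n * ball_volume n <=
  h ^+ n * \sum_(k : {ffun 'I_n -> 'I_K})
     (sqnorm (y - grid_node h c k) <= r ^+ 2)%R%:R.
Proof.
move=> n0 h0 hr cE hK ys; set d := h * Num.sqrt n%:R in hr *.
have q0 : 0 < Num.sqrt n%:R :> R by rewrite sqrtr_gt0 ltr0n.
have d0 : 0 < d by rewrite mulr_gt0.
pose good k := sqnorm (y - @grid_node R n K h c k) <= r ^+ 2.
pose F k : set 'rV[R]_n := if good k then box (grid_node h c k) h else set0.
have rd0 : 0 < r - d by rewrite subr_gt0.
have mF k : sectionally_measurable (F k).
  rewrite /F; case: ifP => _; first exact: (box_volume _ (ltW h0)).1.
  exact: (@sectionally_measurable0 R n).1.
have vF k : volume (F k) = (h ^+ n * (good k)%:R)%:E.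
  rewrite /F; case: ifP => _; first by rewrite mulr1 (box_volume _ (ltW h0)).2.
  by rewrite mulr0 (@sectionally_measurable0 R n).2.
have := @volume_fractional_cover R n _ 1 (affine_ball 1%:M y (r - d)) F ler01 mF.
rewrite (affine_ball_volume _ (unitmx1 _ _) (ltW rd0)).2 det1 normr1 mulr1.
under eq_bigr do rewrite vF.
rewrite mul1e sumEFin lee_fin -mulr_sumr; apply => w.
rewrite /affine_ball /= invmx1 mulmx1 => wy; rewrite mul1r.
have wyi i : `|w 0 i - y 0 i| <= r - d.
  rewrite -(@ler_pXn2r _ 2)// ?nnegrE ?normr_ge0 ?(ltW rd0)//.
  rewrite real_normK ?num_real//; apply: le_trans wy.
  by have := le_sqnorm_coord (w - y) i; rewrite !mxE.
pose t i := (w 0 i + c) / h.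
have t0 i : 0 <= t i.
  rewrite divr_ge0 ?(ltW h0)//; have := ys i; have := wyi i.
  by rewrite cE !ler_norml => /andP[? _] /andP[? _]; lra.
have tK i : (Num.truncn (t i) < K)%N.
  rewrite Num.Theory.truncn_lt_nat// /t ltr_pdivrMr// mulrC hK.
  have := ys i; have := wyi i.
  by rewrite cE !ler_norml => /andP[_ ?] /andP[_ ?]; lra.
pose k : {ffun 'I_n -> 'I_K} := [ffun i => Ordinal (tK i)].
have nk i : grid_node h c k 0 i <= w 0 i <= grid_node h c k 0 i + h.
  rewrite mxE ffunE /=.
  have /andP[t1 t2] := Num.Theory.truncn_itv (t0 i).
  move: t1 t2; rewrite {2 3}/t ler_pdivlMr// ltr_pdivrMr// -[(_ (t i)).+1]addn1 natrD.
  by move=> ? ?; apply/andP; split; lra.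
have gk : good k.
  rewrite /good; have -> : y - grid_node h c k = (y - w) + (w - grid_node h c k).
    by rewrite addrA subrK.
  have -> : r = (r - d) + d by rewrite subrK.
  apply: sqnormD_le => //.
    by rewrite -opprB /sqnorm; under eq_bigr do rewrite mxE sqrrN.
  rewrite /d exprMn sqr_sqrtr ?ler0n// /sqnorm.
  have -> : h ^+ 2 * n%:R = \sum_(i < n) h ^+ 2.
    by rewrite sumr_const card_ord mulr_natr.
  apply: ler_sum => i _; have /andP[? ?] := nk i.
  have -> : (w - grid_node h c k) 0 i = w 0 i - grid_node h c k 0 i.
    by rewrite mxE [X in _ + X]mxE.
  by rewrite ler_pXn2r// ?nnegrE; lra.
rewrite (bigD1 k)//= {1}/F gk indicE mem_set//=.
by rewrite lerDl sumr_ge0// => j _; rewrite indicE.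
Qed.

(** The image of a cube under [M] has at most the volume of the cube times
    the absolute value of the determinant of [M], up to a factor as close to 1 as
    desired.  Take the image of a
    fine grid in each slightly enlarged parallelepiped as a set of centres of
    translates of the ellipsoid [r B M].  By [grid_count] every point of [D] lies
    in many of them, so a small multiple of the sum of their indicators
    dominates that of [D]; the volume of the ball cancels in the result. *)
Lemma volume_le_cube_cover {R : realType} n (M : 'M[R]_n) (J : finType)
    (z : J -> 'rV[R]_n) (s e : R) (D : set 'rV[R]_n) :
  (0 < n)%N -> M \in unitmx -> 0 < s -> 0 < e -> e < 1 ->
  (forall x, D x -> exists j, forall i, `|(x *m invmx M - z j) 0 i| <= s) ->
  (volume D <=
    (#|J|%:R * (2 * s * ((1 + e) / (1 - e))) ^+ n * `|\det M|)%:E)%E.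
Proof.
move=> n0 Mu s0 e0 e1 cov.
pose r := e * s; have r0 : 0 < r by rewrite mulr_gt0.
pose c := s + r; have c0 : 0 < c by rewrite addr_gt0.
set q : R := Num.sqrt n%:R.
have q0 : 0 < q by rewrite sqrtr_gt0 ltr0n.
pose K := (Num.truncn (2 * c * q / (e * r))).+1.
have K0 : 0 < K%:R :> R by rewrite ltr0n.
pose h := 2 * c / K%:R; have h0 : 0 < h by rewrite divr_gt0// mulr_gt0.
have er0 : 0 < e * r by rewrite mulr_gt0.
have hq : h * q <= e * r.
  rewrite /h mulrAC ler_pdivrMr// [leRHS]mulrC -ler_pdivrMr//.
  by apply: ltW; exact: Num.Theory.truncnS_gt.
have hr : h * q < r by rewrite (le_lt_trans hq)// gtr_pMl.
have hK : h * K%:R = 2 * c by rewrite divfK// gt_eqF.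
clearbody h.
pose F (jk : J * {ffun 'I_n -> 'I_K}) : set 'rV[R]_n :=
  affine_ball M ((z jk.1 + grid_node h c jk.2) *m M) r.
have mF jk : sectionally_measurable (F jk).
  exact: (affine_ball_volume _ Mu (ltW r0)).1.
have vF jk : volume (F jk) = (r ^+ n * ball_volume n * `|\det M|)%:E.
  exact: (affine_ball_volume _ Mu (ltW r0)).2.
have v0 := @ball_volume_gt0 R n.
have rh0 : 0 < r - h * q by rewrite subr_gt0.
(* By grid_count, B / h^n is a lower bound for the multiplicity of the cover. *)
pose B := (r - h * q) ^+ n * ball_volume n.
have B0 : 0 < B by rewrite mulr_gt0// exprn_gt0.
have a0 : 0 <= h ^+ n / B by rewrite divr_ge0 ?exprn_ge0 ?ltW.
have := volume_fractional_cover a0 mF (S := D).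
under eq_bigr do rewrite vF.
rewrite sumEFin sumr_const -EFinM => /(_ _)/le_trans; apply; last first.
  rewrite lee_fin card_prod card_ffun !card_ord.
  rewrite -[_ *+ (_ * _)]mulr_natr natrM natrX.
  have -> : h ^+ n / B * (r ^+ n * ball_volume n * `|\det M| * (#|J|%:R * K%:R ^+ n))
     = #|J|%:R * (h * K%:R * (r / (r - h * q))) ^+ n * `|\det M|.
    have : (r - h * q) ^+ n != 0 by rewrite gt_eqF// exprn_gt0.
    have : ball_volume n != 0 :> R by rewrite gt_eqF.
    rewrite /B (exprMn _ (h * _)) [(h * _) ^+ n]exprMn expr_div_n.
    set v := ball_volume n; set t := (r - _) ^+ n.
    by move=> ? ?; field; apply/andP; split.
  have H0 : 0 <= h * K%:R * (r / (r - h * q)).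
    by rewrite hK mulr_ge0 ?divr_ge0 ?mulr_ge0 ?ltW.
  have H : h * K%:R * (r / (r - h * q)) <= 2 * s * ((1 + e) / (1 - e)).
    have -> : 2 * s * ((1 + e) / (1 - e)) = 2 * c * (1 - e)^-1.
      by rewrite /c /r; field; rewrite gt_eqF// subr_gt0.
    rewrite hK ler_wpM2l ?mulr_ge0 ?(ltW c0)//.
    rewrite ler_pdivrMr// mulrC ler_pdivlMr ?subr_gt0//; lra.
  rewrite ler_wpM2r// ler_wpM2l// ler_pXn2r// nnegrE//.
  exact: le_trans H0 H.
move=> x Dx; have [j yj] := cov _ Dx.
set y := x *m invmx M - z j in yj.
have := grid_count n0 h0 hr erefl hK yj; rewrite -/q -/B => cnt.
rewrite mulrAC ler_pdivlMr// mul1r (le_trans cnt)// ler_wpM2l ?exprn_ge0 ?(ltW h0)//.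
rewrite -(pair_big xpredT xpredT (fun j k => \1_(F (j, k)) x))/= (bigD1 j)//=.
rewrite -[leLHS]addr0 lerD//; last first.
  by rewrite sumr_ge0// => j' _; rewrite sumr_ge0// => k _; rewrite indicE.
apply: ler_sum => k _; rewrite indicE ler_nat.
have [hk|//] := boolP (sqnorm (y - grid_node h c k) <= r ^+ 2).
rewrite mem_set//.
rewrite /F /affine_ball /= mulmxBl mulmxK// opprD addrA.
exact: hk.
Qed.

(** * Separation of convex sets *)

Definition dot {R : realType} {n} (x y : 'rV[R]_n) : R := \sum_(i < n) x 0 i * y 0 i.

Lemma dotDr {R : realType} n (u x y : 'rV[R]_n) :
  dot u (x + y) = dot u x + dot u y.
Proof. by rewrite -big_split; apply: eq_bigr => i _; rewrite mxE mulrDr. Qed.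

Lemma dotZr {R : realType} n (u x : 'rV[R]_n) a : dot u (a *: x) = a * dot u x.
Proof. by rewrite /dot mulr_sumr; apply: eq_bigr => i _; rewrite mxE mulrCA. Qed.

Lemma dotNr {R : realType} n (u x : 'rV[R]_n) : dot u (- x) = - dot u x.
Proof. by rewrite -scaleN1r dotZr mulN1r. Qed.

Lemma dotC {R : realType} n (x y : 'rV[R]_n) : dot x y = dot y x.
Proof. by apply: eq_bigr => i _; rewrite mulrC. Qed.

Lemma dotE {R : realType} n (x y : 'rV[R]_n) : dot x y = (x *m y^T) 0 0.
Proof. by rewrite mxE; apply: eq_bigr => i _; rewrite mxE. Qed.

Lemma dot_mulmx {R : realType} n m (x : 'rV[R]_n) (y : 'rV[R]_m)
  (M : 'M[R]_(n, m)) : dot (x *m M) y = dot x (y *m M^T).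
Proof. by rewrite !dotE trmx_mul trmxK mulmxA. Qed.

Lemma sqnormD {R : realType} n (x y : 'rV[R]_n) :
  sqnorm (x + y) = sqnorm x + 2 * dot x y + sqnorm y.
Proof.
rewrite /sqnorm /dot mulr_sumr -!big_split /=; apply: eq_bigr => i _.
by rewrite mxE; ring.
Qed.

Lemma sqnormZ {R : realType} n (x : 'rV[R]_n) a :
  sqnorm (a *: x) = a ^+ 2 * sqnorm x.
Proof. by rewrite /sqnorm mulr_sumr; apply: eq_bigr => i _; rewrite mxE exprMn. Qed.

Lemma sqnorm_dot {R : realType} n (x : 'rV[R]_n) : sqnorm x = dot x x.
Proof. by apply: eq_bigr => i _; rewrite expr2. Qed.

Lemma convex_set_comb {R : realType} n (K : set 'rV[R]_n) x y (t : R) :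
  convex_set K -> K x -> K y -> 0 <= t -> t <= 1 -> K (t *: x + (1 - t) *: y).
Proof.
move=> cK Kx Ky t0 t1.
by have := cK x y (Itv01 t0 t1) (mem_set Kx) (mem_set Ky); rewrite inE.
Qed.

Lemma continuous_sum {R : realType} {T : topologicalType} n (f : 'I_n -> T -> R) :
  (forall i, continuous (f i)) -> continuous (fun x => \sum_i f i x).
Proof. by move=> cf; apply: continuous_big => //; exact: add_continuous. Qed.

Lemma continuous_sqnormB {R : realType} n (x : 'rV[R]_n) :
  continuous (fun y : 'rV[R]_n => sqnorm (y - x)).
Proof.
rewrite /sqnorm; have -> : (fun y : 'rV[R]_n => \sum_i (y - x) 0 i ^+ 2) =
   (fun y => \sum_i (y 0 i - x 0 i) ^+ 2).
  by apply/funext => y; apply: eq_bigr => i _; rewrite !mxE.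
apply: continuous_sum => i y.
apply: (@continuous_comp _ _ _ (fun y : 'rV[R]_n => y 0 i - x 0 i) (fun t : R => t ^+ 2)).
  apply: cvgB; first exact: nbhs_filter.
    exact: coord_continuous.
  by apply: cvg_cst; exact: nbhs_filter.
exact: exprn_continuous.
Qed.

(** The nearest point [y] of [K] to [x] gives the functional [x - y]: moving
    from [y] towards a point of [K] on the wrong side would decrease the
    distance to [x]. *)
Lemma separation {R : realType} n (K : set 'rV[R]_n) x :
  convex_set K -> compact K -> K !=set0 -> ~ K x ->
  exists (u : 'rV[R]_n) (c : R), (forall d, K d -> dot u d <= c) /\ c < dot u x.
Proof.
move=> cK kK K0 Kx.
have [y /set_mem Ky ymin] := EVT_min_rV K0 kK
  (continuous_subspaceT (@continuous_sqnormB R n x)).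
pose u := x - y; exists u, (dot u y); split=> [d Kd|].
  rewrite leNgt; apply/negP => ud.
  pose p := dot u (d - y); pose Q := sqnorm (d - y).
  have p0 : 0 < p by rewrite /p dotDr dotNr subr_gt0.
  have Q0 : 0 <= Q by exact: sqnorm_ge0.
  (* This t is at most 1 and satisfies t * Q < p. *)
  pose t := p / (p + Q).
  have pQ : 0 < p + Q by rewrite ltr_wpDr.
  have t0 : 0 < t by rewrite divr_gt0.
  have t1 : t <= 1 by rewrite ler_pdivrMr// mul1r lerDl.
  have := ymin _ (mem_set (convex_set_comb cK Kd Ky (ltW t0) t1)).
  have -> : t *: d + (1 - t) *: y - x = - u + t *: (d - y).
    by rewrite /u; apply/rowP => i; rewrite !mxE; ring.
  rewrite (_ : y - x = - u); last by rewrite opprB.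
  rewrite sqnormD sqnormZ dotZr -/Q dotC dotNr dotC -/p.
  rewrite -addrA lerDl => h.
  have : t * Q < p.
    by rewrite mulrAC ltr_pdivrMr// mulrDr ltrDr mulr_gt0.
  have : 0 <= t * (t * Q - 2 * p).
    apply: le_trans h _; rewrite le_eqVlt; apply/orP; left; apply/eqP.
    by ring.
  by rewrite pmulr_rge0//; lra.
have u0 : u != 0 by apply/eqP => /eqP; rewrite subr_eq0 => /eqP xy; apply: Kx; rewrite xy.
rewrite -subr_gt0 -dotNr -dotDr -/u -sqnorm_dot.
exact: sqnorm_gt0.
Qed.

(** If a point of the cube were outside [K], take a separating functional [u] and
    the point of [K] in the orthant given by the signs of [u]: there [u] is at
    least its maximum over the cube. *)
Lemma orthants_cover_cube {R : realType} n (K : set 'rV[R]_n) (t : 'rV[R]_n) g :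
  convex_set K -> compact K -> 0 <= g ->
  (forall e : 'I_n -> bool, exists2 x, K x & forall i,
     if e i then t 0 i + g <= x 0 i else x 0 i <= t 0 i - g) ->
  forall y : 'rV[R]_n, (forall i, `|y 0 i - t 0 i| <= g) -> K y.
Proof.
move=> cK kK g0 orth y yt; apply: contrapT => Ky.
have [x0 Kx0 _] := orth (fun=> true).
have [|u [c [uK uy]]] := separation cK kK _ Ky; first by exists x0.
have [x Kx xe] := orth (fun i => 0 <= u 0 i).
have := le_lt_trans (uK _ Kx) uy; rewrite ltNge => /negP; apply.
apply: ler_sum => i _; have := xe i; have := yt i; rewrite ler_norml.
move=> /andP[y1 y2]; case: leP => ui /= xi.
  have yx : y 0 i <= x 0 i by apply: le_trans xi; rewrite -lerBlDl.
  exact: ler_wpM2l.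
have yx : x 0 i <= y 0 i by apply: le_trans xi _; move: y1; rewrite lerBrDr addrC.
by have := ler_wnM2l (ltW ui) yx.
Qed.

(** [K] contains the cube around [t] and, by symmetry, the one around [- t];
    averaging them recentres the cube at the origin. *)
Lemma symmetric_orthants_cover_cube {R : realType} n (K : set 'rV[R]_n)
    (t : 'rV[R]_n) g :
  convex_set K -> compact K -> (forall x, K x -> K (- x)) -> 0 <= g ->
  (forall e : 'I_n -> bool, exists2 x, K x & forall i,
     if e i then t 0 i + g <= x 0 i else x 0 i <= t 0 i - g) ->
  forall y : 'rV[R]_n, (forall i, `|y 0 i| <= g) -> K y.
Proof.
move=> cK kK sK g0 orth y yg.
have Kp : K (t + y).
  by apply: (orthants_cover_cube cK kK g0 orth) => i; rewrite !mxE addrAC subrr add0r.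
have Km : K (- (t - y)).
  apply: sK; apply: (orthants_cover_cube cK kK g0 orth) => i.
  by rewrite !mxE addrAC subrr add0r normrN.
have h0 : (0 : R) <= 1 / 2 by lra.
have h1 : (1 / 2 : R) <= 1 by lra.
have := convex_set_comb cK Kp Km h0 h1; congr K.
by apply/rowP => i; rewrite !mxE; field.
Qed.

Lemma continuous_mulmxr {R : realType} n m (F : 'M[R]_(n, m)) :
  continuous (fun x : 'rV[R]_n => x *m F).
Proof.
move=> x; apply/cvgrPdist_le; first exact: nbhs_filter.
move=> e e0 /=.
have H j : \forall y \near x, `|(x *m F) 0 j - (y *m F) 0 j| <= e.
  have cj : continuous (fun y : 'rV[R]_n => (y *m F) 0 j).
    have -> : (fun y : 'rV[R]_n => (y *m F) 0 j) = (fun y => \sum_i y 0 i * F i j).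
      by apply/funext => y; rewrite mxE.
    apply: continuous_sum => i y.
    apply: cvgM; first exact: nbhs_filter.
      exact: coord_continuous.
    by apply: cvg_cst; exact: nbhs_filter.
  by have /cvgrPdist_le/(_ _ e0) := cj x.
have FF : Filter (nbhs x) by exact: nbhs_filter.
have := @filter_forall _ _ _ _ FF H.
apply: (@filterS _ _ FF) => y Hy.
rewrite /Num.norm/= mx_normrE; apply/bigmax_leP; split; first exact: ltW.
by move=> [i j] _ /=; rewrite ord1 mxE [X in _ + X]mxE; exact: Hy.
Qed.

(** * The Dvoretzky-Rogers lemma *)

(** Sylvester's identity: two eliminations of one block matrix. *)
Lemma det_1D_mulmx {R : realType} m n (A : 'M[R]_(m, n)) (B : 'M[R]_(n, m)) :
  \det (1%:M + A *m B) = \det (1%:M + B *m A).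
Proof.
have H p q (X : 'M[R]_(p, q)) (Y : 'M[R]_(q, p)) :
    \det (block_mx 1%:M (- X) Y 1%:M) = \det (1%:M + X *m Y).
  rewrite det_block_schur ?unitmx1// invmx1 mulmx1 det1 mulr1.
  by rewrite mulNmx opprK.
rewrite -H.
have -> : block_mx 1%:M (- A) B 1%:M =
    block_mx 1%:M 0 B 1%:M *m block_mx 1%:M (- A) 0 (1%:M + B *m A).
  rewrite mulmx_block !mul1mx !mul0mx !mulmx1 !addr0.
  by rewrite mulmxN [_ + B *m A]addrC addrA addNr add0r.
by rewrite det_mulmx det_lblock det_ublock !det1 !mul1r.
Qed.

Lemma bernoulli_le {R : realType} (x : R) k : 0 <= 1 + x ->
  1 + k%:R * x <= (1 + x) ^+ k.
Proof.
move=> x1; elim: k => [|k IHk]; first by rewrite mul0r addr0 expr0.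
rewrite exprS; apply: le_trans (ler_wpM2l x1 IHk).
rewrite -natr1 -subr_ge0.
have -> : (1 + x) * (1 + k%:R * x) - (1 + (k%:R + 1) * x) = k%:R * x ^+ 2 by ring.
by rewrite mulr_ge0 ?sqr_ge0.
Qed.

Section DvoretzkyRogers.
Context {R : realType} (n : nat) (D : set 'rV[R]_n) (xi : R).
Hypothesis n0 : (0 < n)%N.
Hypothesis xi0 : 0 < xi.

(** The step of the perturbation of the ball: directions orthogonal to the span
    of the [m] vectors already chosen have their squared length multiplied by
    [1 + tau (m + xi)], those in the span by [1 - tau (n - m)].  To first order the
    logarithm of the squared determinant grows by [tau (n - m) xi], and [dr_tau]
    is small enough for the second order terms to be at most half of this. *)
Definition dr_tau : R := xi / (2 * n%:R ^+ 2 * (n%:R + xi)).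

Lemma dr_tau_gt0 : 0 < dr_tau.
Proof.
have nR : 0 < n%:R :> R by rewrite ltr0n.
by rewrite divr_gt0// !mulr_gt0// ?exprn_gt0// addr_gt0.
Qed.

Lemma stretch_gain m j : (0 < j)%N -> (m + j)%N = n ->
  [/\ 0 <= 1 - dr_tau * j%:R &
   1 + dr_tau * xi / 2 <=
     (1 + dr_tau * (m%:R + xi)) ^+ j * (1 - dr_tau * j%:R) ^+ m].
Proof.
move=> j0 mj; have t0 := dr_tau_gt0; set t := dr_tau in t0 *.
have nE : n%:R = m%:R + j%:R :> R by rewrite -natrD mj.
have jR : 1 <= j%:R :> R by rewrite ler1n.
have mR : 0 <= m%:R :> R by [].
have tE : t * (2 * n%:R ^+ 2 * (n%:R + xi)) = xi.
  rewrite /t /dr_tau divfK// gt_eqF// !mulr_gt0// ?exprn_gt0 ?ltr0n// addr_gt0//.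
  by rewrite ltr0n.
rewrite nE in tE.
move: mR jR tE xi0 t0; set M : R := m%:R; set J : R := j%:R; set x := xi.
move=> M0 J1 tE x0 t0.
have b1 : t * J <= 1 / 2.
  have h1 : 0 < M + J + x by lra.
  have : t * (2 * (M + J) ^+ 2) <= 1.
    rewrite -(ler_pM2r h1) mul1r -mulrA tE; lra.
  move=> h; suff : t * J <= t * (M + J) ^+ 2 by lra.
  by rewrite ler_pM2l//; nra.
have b0 : 0 <= 1 - t * J by lra.
split=> //.
have a0 : 0 <= t * (M + x) by rewrite mulr_ge0 ?ltW//; lra.
have h1 : 1 + J * (t * (M + x)) <= (1 + t * (M + x)) ^+ j.
  by apply: bernoulli_le; lra.
have h2 : 1 + M * (- (t * J)) <= (1 - t * J) ^+ m.
  by apply: bernoulli_le; lra.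
have h3 : 0 <= (1 - t * J) ^+ m by rewrite exprn_ge0.
have h4 : 0 <= 1 + J * (t * (M + x)) by rewrite addr_ge0// mulr_ge0//; lra.
apply: le_trans (ler_wpM2r h3 h1); apply: le_trans (ler_wpM2l h4 h2).
rewrite -subr_ge0.
have -> : (1 + J * (t * (M + x))) * (1 + M * - (t * J)) - (1 + t * x / 2) =
  t * (J * x - x / 2 - J * (t * (J * (M * (M + x))))) by field.
rewrite mulr_ge0 ?(ltW t0)//.
have h5 : t * (J * (M * (M + x))) <= x / 2.
  rewrite -[in leRHS]tE -mulrA ler_pM2l//.
  have -> : 2 * (M + J) ^+ 2 * (M + J + x) / 2 = (M + J) ^+ 2 * (M + J + x) by field.
  rewrite mulrA; apply: ler_pM; [nra|lra|nra|lra].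
have : J * (t * (J * (M * (M + x)))) <= J * (x / 2) by rewrite ler_wpM2l//; lra.
by move=> ?; nra.
Qed.

Hypothesis ballD : forall y, sqnorm y <= 1 -> D y.
Hypothesis ball_maximal : forall S : 'M[R]_n,
  (forall y, sqnorm y <= 1 -> D (y *m S)) ->
  \det S ^+ 2 < 1 + dr_tau * xi / 2.
Hypothesis sepD : forall x, ~ D x ->
  exists u, (forall d, D d -> dot u d <= 1) /\ 1 < dot u x.

Lemma polar_sqnorm_le1 (u : 'rV[R]_n) :
  (forall d, D d -> dot u d <= 1) -> sqnorm u <= 1.
Proof.
move=> uD; have [->|u0] := eqVneq u 0.
  by rewrite /sqnorm big1// => i _; rewrite mxE expr0n.
have s0 := sqnorm_gt0 u0; set N := Num.sqrt (sqnorm u).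
have N0 : 0 < N by rewrite sqrtr_gt0.
have NN : N ^+ 2 = sqnorm u by rewrite sqr_sqrtr ?ltW.
have : dot u (N^-1 *: u) <= 1.
  by apply/uD/ballD; rewrite sqnormZ exprVn NN mulVf// gt_eqF.
rewrite dotZr -sqnorm_dot -NN expr2 mulKf ?gt_eqF// => N1.
by rewrite mulr_ile1// ltW.
Qed.

(** With [Q] the orthogonal projection onto the span of the rows of [U] and
    [P = 1 - Q], the perturbed ball is the image of [B] under
    [S = sg P + la Q].  It leaves [D], so some [u] in the polar satisfies
    [|u S| > 1] while [|u| <= 1]; hence [u P u^T] is at least
    [(n - m) / (n + xi)], and by Schur complements this is the factor by which
    the Gram determinant is multiplied. *)
Lemma dvoretzky_rogers_step m (U : 'M[R]_(m, n)) : (m < n)%N ->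
  0 < \det (U *m U^T) ->
  exists2 u, (forall d, D d -> dot u d <= 1) &
    (n - m)%:R / (n%:R + xi) * \det (U *m U^T) <=
    \det (col_mx u U *m (col_mx u U)^T).
Proof.
move=> mn G0; set G := U *m U^T in G0 *.
have Gu : G \in unitmx by rewrite unitmxE unitfE gt_eqF.
pose Q := U^T *m invmx G *m U; pose P := 1%:M - Q.
have GT : (invmx G)^T = invmx G by rewrite trmx_inv /G trmx_mul trmxK.
have QT : Q^T = Q by rewrite /Q !trmx_mul trmxK GT !mulmxA.
have QQ : Q *m Q = Q.
  rewrite /Q -!mulmxA [U *m (U^T *m _)]mulmxA -/G.
  by rewrite [invmx G *m (G *m _)]mulmxA mulVmx// mul1mx.
have PT : P^T = P by rewrite /P linearB/= trmx1 QT.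
have PP : P *m P = P by rewrite /P mulmxBl mul1mx mulmxBr mulmx1 QQ subrr subr0.
have PQ : P *m Q = 0 by rewrite /P mulmxBl mul1mx QQ subrr.
have QP : Q *m P = 0 by rewrite /P mulmxBr mulmx1 QQ subrr.
have j0 : (0 < n - m)%N by rewrite subn_gt0.
have [b0 gain] := stretch_gain j0 (subnKC (ltnW mn)).
have t0 := dr_tau_gt0; set t := dr_tau in t0 b0 gain *.
set a := t * (m%:R + xi) in gain; set b := t * (n - m)%:R in b0 gain.
have a0 : 0 < a by rewrite mulr_gt0// ltr_wpDl.
set sg := Num.sqrt (1 + a); set la := Num.sqrt (1 - b).
have sg2 : sg ^+ 2 = 1 + a by rewrite sqr_sqrtr//; lra.
have la2 : la ^+ 2 = 1 - b by rewrite sqr_sqrtr.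
have sg0 : 0 < sg by rewrite sqrtr_gt0; lra.
pose S := sg *: P + la *: Q.
have ST : S^T = S by rewrite /S linearD/= !linearZ/= PT QT.
have SS : S *m S = (1 + a) *: P + (1 - b) *: Q.
  rewrite /S mulmxDl !mulmxDr -!scalemxAl -!scalemxAr PP QQ PQ QP !scaler0.
  by rewrite addr0 add0r !scalerA -!expr2 sg2 la2.
have detS : \det S = sg ^+ n * (la / sg) ^+ m.
  have -> : S = sg *: (1%:M + (((la - sg) / sg) *: U^T) *m (invmx G *m U)).
    rewrite -scalemxAl mulmxA -/Q scalerDr scalerA mulrC divfK ?gt_eqF//.
    by rewrite /S /P scalerBr scalerBl addrA addrAC.
  rewrite detZ det_1D_mulmx -scalemxAr -mulmxA -/G mulVmx//.
  rewrite scalemx1 -raddfD det_scalar; congr (_ * _ ^+ _).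
  by field; rewrite gt_eqF.
have nS : ~ (forall y, sqnorm y <= 1 -> D (y *m S)).
  move=> /ball_maximal; rewrite ltNge => /negP; apply.
  apply: le_trans gain _; rewrite detS.
  rewrite exprMn (exprAC _ n) (exprAC _ m) (expr_div_n la) sg2 la2.
  rewrite -[in leRHS](subnKC (ltnW mn)) exprD le_eqVlt; apply/orP; left; apply/eqP.
  rewrite expr_div_n.
  have : (1 + a) ^+ m != 0 by rewrite gt_eqF// exprn_gt0//; lra.
  by set z := (1 + a) ^+ m => z0; field.
have [y [y1 /sepD[u [uD uy]]]] : exists y, sqnorm y <= 1 /\ ~ D (y *m S).
  apply: contrapT => h; apply: nS => y y1; apply: contrapT => h'.
  by apply: h; exists y.
have uS1 : 1 < sqnorm (u *m S).
  move: uy; rewrite dotC dot_mulmx ST dotC => uy.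
  have := sqnorm_ge0 (u *m S + (- 1) *: y).
  by rewrite sqnormD dotZr sqnormZ sqrrN expr1n; lra.
pose p := (u *m P *m u^T) 0 0; pose q := (u *m Q *m u^T) 0 0.
have pq : p + q <= 1.
  have := polar_sqnorm_le1 uD; congr (_ <= _).
  have -> : p + q = (u *m P *m u^T + u *m Q *m u^T) 0 0 by rewrite mxE.
  by rewrite sqnormE -mulmxDl -mulmxDr /P subrK mulmx1.
have spq : sqnorm (u *m S) = (1 + a) * p + (1 - b) * q.
  rewrite sqnormE trmx_mul ST mulmxA -[u *m S *m S]mulmxA SS.
  rewrite mulmxDr mulmxDl -!scalemxAr -!scalemxAl.
  by rewrite mxE [X in X + _]mxE [X in _ + X]mxE.
have pb : b < (a + b) * p by move: uS1; rewrite spq; nra.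
exists u => //.
have -> : \det (col_mx u U *m (col_mx u U)^T) = p * \det G.
  rewrite tr_col_mx mul_col_row det_block_schur//; congr (_ * _).
  rewrite det_mx11 /p /P mulmxBr mulmx1 mulmxBl; congr (fun_of_matrix (_ - _) _ _).
  by rewrite /Q !mulmxA.
rewrite ler_wpM2r ?(ltW G0)// ler_pdivrMr; last first.
  by rewrite ltr_wpDl.
have nE : n%:R = m%:R + (n - m)%:R :> R by rewrite -natrD subnKC// ltnW.
apply: ltW; move: pb; rewrite /a /b -mulrDr -mulrA ltr_pM2l// mulrC.
by rewrite nE addrAC.
Qed.

Lemma dvoretzky_rogers : exists U : 'M[R]_n,
  (forall i d, D d -> dot (row i U) d <= 1) /\
  n`!%:R / (n%:R + xi) ^+ n <= \det U ^+ 2.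
Proof.
suff H m : (m <= n)%N -> exists U : 'M[R]_(m, n),
    (forall i d, D d -> dot (row i U) d <= 1) /\
    \prod_(i < m) ((n - i)%:R / (n%:R + xi)) <= \det (U *m U^T).
  have [U [Up Ud]] := H n (leqnn n); exists U; split=> //.
  move: Ud; rewrite det_mulmx det_tr -expr2; apply: le_trans.
  by rewrite prodf_div prodr_const card_ord -natr_prod -ffact_prod ffactnn.
elim: m => [|m IHm] mn.
  exists 0; split; first by case.
  by rewrite big_ord0 det_mx00.
have [U [Up Ud]] := IHm (ltnW mn).
have nx : 0 < n%:R + xi by rewrite ltr_wpDl.
have pr0 : 0 < \prod_(i < m) ((n - i)%:R / (n%:R + xi)) :> R.
  apply: prodr_gt0 => i _; rewrite divr_gt0// ltr0n subn_gt0.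
  by rewrite (ltn_trans (ltn_ord i)).
have [u uD ud] := dvoretzky_rogers_step mn (lt_le_trans pr0 Ud).
exists (col_mx u U); split.
  suff H (i : 'I_(1 + m)) d : D d -> dot (row i (col_mx u U)) d <= 1 by exact: H.
  move=> Dd; case: (split_ordP i) => k ->.
    by rewrite rowKu ord1 row_id; exact: uD.
  by rewrite rowKd; exact: Up.
apply: le_trans ud; rewrite big_ord_recr/= mulrC ler_wpM2l// divr_ge0// ltW//.
Qed.

End DvoretzkyRogers.

(** * Shattering *)

Section Shattering.
Local Open Scope set_scope.
Variables (n q : nat).
Implicit Types (A : {set {ffun 'I_n -> 'I_q}}) (g : {ffun 'I_n -> option 'I_q}).

(** For [q = 2] this is the shattering of the Sauer-Shelah lemma. *)
Definition shatters A g : bool :=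
  [forall e : {ffun 'I_n -> bool}, [exists x in A, [forall i,
     if g i is Some h then (h < x i)%N == e i else true]]].

Definition pattern_support g : {set 'I_n} := [set i | isSome (g i)].

Lemma shattersP A g : reflect
  (forall e : 'I_n -> bool, exists2 x : {ffun 'I_n -> 'I_q}, x \in A &
     forall i h, g i = Some h -> (h < x i)%N = e i)
  (shatters A g).
Proof.
apply: (iffP forallP) => [H e|H e].
  have /existsP[x /andP[xA /forallP xe]] := H (finfun e).
  by exists x => // i h gi; have := xe i; rewrite gi ffunE => /eqP.
have [x xA xe] := H e; apply/existsP; exists x; rewrite xA /=.
by apply/forallP => i; case gi: (g i) => [h|//]; rewrite (xe _ _ gi).
Qed.

Lemma shatters_sub A A' g : A \subset A' -> shatters A g -> shatters A' g.
Proof.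
move=> /fintype.subsetP AA' /shattersP H; apply/shattersP => e.
by have [x xA xe] := H e; exists x => //; exact: AA'.
Qed.

(** Pajor's form of the Sauer-Shelah lemma for [q] letters, localized to the
    coordinates in [I] so that the induction stays in one type.  Split [A] by the
    letter [a] at a coordinate [i0] of [I].  A pattern [g] without [i0] that is
    shattered by the fibers of several letters is shattered by [A]; moreover, if
    [a] is not the largest of these letters, then adding to [g] the threshold [a]
    at [i0] gives a shattered pattern, using the fiber of [a] below and that of a
    larger letter above.  The map [phi] records this and is injective. *)
Lemma card_le_shattered_in (I : {set 'I_n}) A :
  (forall x y i, x \in A -> y \in A -> i \notin I -> x i = y i) ->
  (#|A| <= #|[set g | shatters A g & pattern_support g \subset I]|)%N.
Proof.
have [k] := ubnP #|I|; elim: k => // k IHk in I A *; rewrite ltnS => Ik agree.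
have [I0|[i0 i0I]] := set_0Vmem I.
  have [->|[x xA]] := set_0Vmem A; first by rewrite cards0.
  have -> : A = [set x].
    apply/setP => y; rewrite inE; apply/idP/eqP => [yA|->//].
    by apply/ffunP => i; apply: agree; rewrite // I0 inE.
  rewrite cards1 card_gt0; apply/set0Pn; exists [ffun=> None]; rewrite inE.
  apply/andP; split; last by apply/fintype.subsetP => i; rewrite inE ffunE.
  by apply/shattersP => e; exists x => [|i h]; rewrite ?inE// ffunE.
pose I' := I :\ i0.
pose fiber a := [set x in A | x i0 == a].
have fiberA a : fiber a \subset A by apply/fintype.subsetP => x; rewrite inE => /andP[].
have cardI' : (#|I'| < k)%N by rewrite (leq_trans _ Ik)// [leqRHS](cardsD1 i0) i0I.
have IHfiber a : (#|fiber a| <=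
    #|[set g | shatters (fiber a) g & pattern_support g \subset I']|)%N.
  apply: IHk => // x y i; rewrite !inE => /andP[xA /eqP xa] /andP[yA /eqP ya].
  by rewrite negb_and negbK => /orP[/eqP->|iI]; [rewrite xa ya|exact: agree].
pose pairs := [set ga : {ffun 'I_n -> option 'I_q} * 'I_q |
  shatters (fiber ga.2) ga.1 & pattern_support ga.1 \subset I'].
have card_pairs : (#|A| <= #|pairs|)%N.
  rewrite -sum1_card (partition_big (fun x : {ffun _ -> _} => x i0) xpredT)//=.
  rewrite -[in leqRHS]sum1_card.
  rewrite (partition_big (fun ga => ga.2) xpredT)//=.
  apply: leq_sum => a _.
  apply: (@leq_trans #|fiber a|).
    by rewrite -sum1_card; apply: eq_leq; apply: eq_bigl => x; rewrite inE.
  apply: leq_trans (IHfiber a) _.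
  rewrite sum1_card -(card_imset _ (can_inj (fun g => erefl : (g, a).1 = g))).
  apply: subset_leq_card; apply/fintype.subsetP => _ /imsetP[g gP ->].
  by move: gP; rewrite inE => gP; apply/andP; split; rewrite ?inE//=.
apply: leq_trans card_pairs _.
pose top (g : {ffun 'I_n -> option 'I_q}) (a : 'I_q) :=
  [forall b, shatters (fiber b) g ==> (b <= a)%N].
(* The largest letter keeps the pattern, the others become a threshold. *)
pose phi (ga : {ffun 'I_n -> option 'I_q} * 'I_q) : {ffun 'I_n -> option 'I_q} :=
  if top ga.1 ga.2 then ga.1
  else [ffun i => if i == i0 then Some ga.2 else ga.1 i].
have none_i0 (g : {ffun 'I_n -> option 'I_q}) :
    pattern_support g \subset I' -> g i0 = None.
  move=> /fintype.subsetP/(_ i0); rewrite !inE eqxx /=; case: (g i0) => // a.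
  by move=> /(_ isT).
have phi_inj : {in pairs &, injective phi}.
  move=> [g a] [g' a']; rewrite !inE /= => /andP[sa /none_i0 g0] /andP[sa' /none_i0 g0'].
  rewrite /phi /=; case: ifPn => [ta|_]; case: ifPn => [ta'|_].
  - move=> gg'; rewrite -{}gg' in sa' ta' *; congr (_, _); apply/val_inj/eqP.
    have /implyP/(_ sa) aa' := forallP ta' a.
    have /implyP/(_ sa') a'a := forallP ta a'.
    by rewrite eqn_leq aa' a'a.
  - by move=> /ffunP/(_ i0); rewrite ffunE eqxx g0.
  - by move=> /ffunP/(_ i0); rewrite ffunE eqxx g0'.
  - move=> /ffunP E; have := E i0; rewrite !ffunE eqxx => -[->]; congr (_, _).
    apply/ffunP => i; have := E i; rewrite !ffunE.
    by case: eqP => [->|//]; rewrite g0 g0'.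
rewrite -(card_in_imset phi_inj); apply: subset_leq_card.
apply/fintype.subsetP => _ /imsetP[[g a] + ->]; rewrite !inE /= => /andP[sa sI'].
rewrite /phi /=; case: ifPn => [ta|nta].
  by rewrite (shatters_sub (fiberA a))// (fintype.subset_trans sI')// finset.subsetDl.
move: nta; rewrite negb_forall => /existsP[b]; rewrite negb_imply -ltnNge.
move=> /andP[sb ab]; apply/andP; split; last first.
  apply/fintype.subsetP => i; rewrite inE ffunE; case: eqP => [->//|_ gi].
  have := fintype.subsetP sI' i; rewrite !inE => /(_ gi)/andP[_].
  by [].
apply/shattersP => e.
have /shattersP/(_ e)[x] : shatters (fiber (if e i0 then b else a)) g by case: (e i0).
rewrite inE => /andP[xA /eqP xi0] xe; exists x => // i h.
rewrite ffunE; case: eqP => [-> [<-]|_]; last exact: xe.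
by rewrite xi0; case: (e i0) => //; rewrite ltnn.
Qed.

Lemma card_le_shattered A : (#|A| <= #|[set g | shatters A g]|)%N.
Proof.
apply: leq_trans (@card_le_shattered_in (finset.setTfor 'I_n) A _) _.
  by move=> x y i; rewrite inE.
by apply: subset_leq_card; apply/fintype.subsetP => g; rewrite !inE => /andP[].
Qed.

Lemma card_support_eq (I : {set 'I_n}) :
  (#|[set g | pattern_support g == I]| <= q ^ #|I|)%N.
Proof.
pose F i := if i \in I then [pred o : option 'I_q | isSome o] else pred1 None.
apply: (@leq_trans #|family F|).
  apply: subset_leq_card; apply/fintype.subsetP => g; rewrite inE => /eqP gI.
  apply/familyP => i; rewrite /F -gI inE.
  by case: (g i) => [h|]; rewrite inE.
rewrite card_family foldrE big_map big_enum /=.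
rewrite (bigID [in I])/= [X in (_ * X)%N]big1 => [|i /negbTE iI]; last first.
  by rewrite /F iI card1.
rewrite muln1 -prod_nat_const; apply: leq_prod => i iI; rewrite /F iI.
have := cardC1 (None : option 'I_q); rewrite card_option card_ord /= => E.
by rewrite -[leqRHS]E; apply: subset_leq_card; apply/fintype.subsetP => -[].
Qed.

(** Each of the [2 ^ n] supports [I] carries at most [q ^ #|I|] patterns, and only
    the supports with [q ^ #|I| < 2 ^ n] count. *)
Lemma card_small_support :
  (#|[set g | q ^ #|pattern_support g| < 2 ^ n]| < 4 ^ n)%N.
Proof.
have -> : (#|[set g | q ^ #|pattern_support g| < 2 ^ n]| = \sum_(I : {set 'I_n})
   #|[set g | (q ^ #|pattern_support g| < 2 ^ n) && (pattern_support g == I)]|)%N.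
  rewrite -sum1_card (partition_big pattern_support xpredT)//=.
  apply: eq_bigr => I _; rewrite -sum1_card; apply: eq_bigl => g.
  by rewrite !inE.
have le_I (I : {set 'I_n}) :
  (#|[set g | (q ^ #|pattern_support g| < 2 ^ n) && (pattern_support g == I)]|
   <= (2 ^ n).-1)%N.
  rewrite -ltnS prednK ?expn_gt0//.
  have [h|h] := ltnP (q ^ #|I|) (2 ^ n).
    apply: leq_ltn_trans h; apply: leq_trans (card_support_eq I).
    by apply: subset_leq_card; apply/fintype.subsetP => g; rewrite !inE => /andP[].
  rewrite (_ : [set g | _] = finset.set0) ?cards0 ?expn_gt0//; apply/setP => g.
  rewrite !inE; apply/negbTE/negP => /andP[+ /eqP E]; rewrite E.
  by rewrite ltnNge h.
apply: leq_ltn_trans (leq_sum _ (fun I _ => le_I I)) _.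
rewrite sum_nat_const (_ : #|_| = 2 ^ n)%N; last first.
  by rewrite -cardsT -powersetT card_powerset cardsT card_ord.
rewrite (_ : 4 = 2 * 2)%N// expnMn ltn_pmul2l ?expn_gt0//.
by rewrite prednK ?expn_gt0.
Qed.

(** Thresholds alone would separate neighbouring letters only.  Inside a class
    of fixed parities, letters on different sides of a threshold differ by at
    least 2, so a whole letter [m i] fits strictly between them; passing to the
    largest of the [2 ^ n] classes costs the factor [2 ^ n]. *)
Lemma gap_shattering A : (8 ^ n <= #|A|)%N ->
  exists (I : {set 'I_n}) (m : 'I_n -> nat), (2 ^ n <= q ^ #|I|)%N /\
    forall e : 'I_n -> bool, exists2 x : {ffun 'I_n -> 'I_q}, x \in A &
      forall i, i \in I -> if e i then (m i < x i)%N else (x i < m i)%N.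
Proof.
move=> hA.
pose par (x : {ffun 'I_n -> 'I_q}) : {ffun 'I_n -> bool} := [ffun i => odd (x i)].
pose cls p := [set x in A | par x == p].
have [p hp] : exists p, (4 ^ n <= #|cls p|)%N.
  apply/existsP; apply: contraTT hA => /existsPn H; rewrite -ltnNge.
  rewrite -sum1_card (partition_big par xpredT)//=.
  apply: leq_ltn_trans (_ : \sum_(p : {ffun 'I_n -> bool}) (4 ^ n).-1 < _)%N.
    apply: leq_sum => p _; rewrite -ltnS prednK ?expn_gt0//.
    move: (H p); rewrite -ltnNge; apply: leq_trans; rewrite ltnS.
    by rewrite -sum1_card; apply: eq_leq; apply: eq_bigl => x; rewrite inE.
  rewrite sum_nat_const card_ffun card_bool card_ord.
  rewrite (_ : 8 = 2 * 4)%N// expnMn ltn_pmul2l ?expn_gt0//.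
  by rewrite prednK ?expn_gt0.
have [g /andP[sg big]] : exists g, shatters (cls p) g &&
    (2 ^ n <= q ^ #|pattern_support g|)%N.
  apply/existsP; apply: contraT => /existsPn H.
  have := leq_trans hp (card_le_shattered (cls p)).
  rewrite leqNgt => /negP[]; apply: leq_ltn_trans card_small_support.
  apply: subset_leq_card; apply/fintype.subsetP => g; rewrite !inE => sg.
  by have := H g; rewrite sg /= -ltnNge.
exists (pattern_support g).
(* The first letter above the threshold that is not of the parity of the class. *)
exists (fun i => if g i is Some h then (h + (odd h == p i))%N else 0%N); split=> // e.
have /shattersP/(_ e)[x] := sg; rewrite inE => /andP[xA /eqP xp] xe.
exists x => // i; rewrite inE; case gi: (g i) => [h|//] _.
have := xe _ _ gi; have := congr1 (fun f : {ffun 'I_n -> bool} => f i) xp.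
rewrite /= ffunE => <- <-.
by case: ltnP => hx; case: eqP => /= E; lia.
Qed.

End Shattering.

(** * Covering numbers of a body with large volume ratio *)

Lemma volume_fin {R : realType} n (D : set 'rV[R]_n) : (0 < n)%N ->
  compact D -> volume D \is a fin_num.
Proof.
move=> n0 /compact_bounded/ex_strict_bound_gt0[s s0 /= Ds].
rewrite ge0_fin_numE ?volume_ge0//.
have h0 : (0 : R) < 1 / 2 by lra.
have h1 : (1 / 2 : R) < 1 by lra.
apply: le_lt_trans (@volume_le_cube_cover R n 1%:M unit (fun=> 0) s (1 / 2) D
  n0 (unitmx1 _ _) s0 h0 h1 _) _; last by rewrite ltry.
move=> x Dx; exists tt => i; rewrite invmx1 mulmx1 subr0.
apply: le_trans (ltW (Ds _ Dx)).
by rewrite [leRHS]/Num.norm/= mx_normrE; apply/bigmax_geP; right; exists (0, i).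
Qed.

(** The hypothesis on the volume ratio applied to the ellipsoid [B N]. *)
Lemma volume_ratio_le {R : realType} n (A : R) (D : set 'rV[R]_n) (N : 'M[R]_n) :
  (0 < n)%N -> 0 < A -> N \in unitmx ->
  (forall y, sqnorm y <= 1 -> D (y *m N)) ->
  ((A^-1 * Num.sqrt n%:R)%:E <= volume_ratio D)%E ->
  (A^-1 * Num.sqrt n%:R) ^+ n * (ball_volume n * `|\det N|) <= fine (volume D).
Proof.
move=> n0 A0 Nu ND vr.
pose E := [set 0 + x *m N | x in euclidean_ball R n].
have EN : E = affine_ball N 0 1.
  apply/seteqP; split => z; rewrite /affine_ball /= subr0 expr1n.
    by move=> [y y1 <-]; rewrite add0r mulmxK.
  by move=> z1; exists (z *m invmx N); rewrite ?add0r ?mulmxKV.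
have vE : volume E = (ball_volume n * `|\det N|)%:E.
  by rewrite EN (affine_ball_volume _ Nu ler01).2 expr1n mul1r.
have d0 : 0 < `|\det N| by rewrite normr_gt0 -unitfE -unitmxE.
have v0 : 0 < ball_volume n * `|\det N| by rewrite mulr_gt0// ball_volume_gt0.
have : ((A^-1 * Num.sqrt n%:R)%:E <=
    ((fine (volume D) / fine (volume E)) `^ n%:R^-1)%:E)%E.
  apply: le_trans vr _; apply: ereal_inf_lbound; exists E => //; split.
    by exists 0, N.
  by move=> _ [y y1 <-]; rewrite add0r; exact: ND.
rewrite lee_fin vE /= => h.
have w0 : 0 <= fine (volume D) / (ball_volume n * `|\det N|).
  by rewrite divr_ge0 ?(ltW v0)// fine_ge0// volume_ge0.
rewrite -ler_pdivlMr//.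
have nR : n%:R != 0 :> R by rewrite pnatr_eq0 -lt0n.
have E1 : fine (volume D) / (ball_volume n * `|\det N|) =
   ((fine (volume D) / (ball_volume n * `|\det N|)) `^ n%:R^-1) ^+ n.
  by rewrite -powR_mulrn ?powR_ge0// -powRrM mulVf// powRr1.
rewrite [leRHS]E1; apply: lerXn2r => //; rewrite nnegrE ?powR_ge0//.
by rewrite mulr_ge0 ?invr_ge0 ?(ltW A0) ?sqrtr_ge0.
Qed.

(** Average a ball inside [D] with its reflection in the origin. *)
Lemma symmetric_body_contains_ball {R : realType} n (D : set 'rV[R]_n) :
  symmetric_convex_body D ->
  exists2 r : R, 0 < r & forall y : 'rV[R]_n, sqnorm y <= 1 -> D (r *: y).
Proof.
move=> [cD _ [x0 /nbhs_ballP[e /= e0 Dx0]] sD].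
exists (e / 2); first by rewrite divr_gt0.
have e2 : 0 < e / 2 by rewrite divr_gt0.
have near_x0 (y : 'rV[R]_n) : sqnorm y <= 1 -> D (x0 + (e / 2) *: y).
  move=> y1; apply: Dx0; rewrite -ball_normE /= opprD addrA subrr sub0r normrN.
  rewrite /Num.norm/= mx_normrE; apply/bigmax_ltP; split=> // -[i j] _ /=.
  rewrite ord1 mxE normrM gtr0_norm//.
  have yj : `|y 0 j| <= 1.
    rewrite -(@expr_le1 _ 2%N)// real_normK ?num_real//.
    exact: le_trans (le_sqnorm_coord y j) y1.
  apply: (@le_lt_trans _ _ (e / 2)); first by rewrite ler_piMr// ltW.
  by lra.
move=> y y1.
have D1 := near_x0 _ y1.
have D2 : D (- (x0 + (e / 2) *: (- y))).
  by apply/sD/near_x0; rewrite -scaleN1r sqnormZ sqrrN expr1n mul1r.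
have h0 : (0 : R) <= 1 / 2 by lra.
have h1 : (1 / 2 : R) <= 1 by lra.
have := convex_set_comb cD D1 D2 h0 h1; congr D.
by apply/rowP => i; rewrite !mxE; field.
Qed.

(** The ellipsoid [B N] has almost maximal volume among the centred ones in [D]:
    the admissible loss is dictated by the gain in volume in the proof of
    [dvoretzky_rogers], which is applied to the image of [D] under the inverse of
    [N].  The volumes of the ellipsoids are bounded because of the hypothesis on
    the volume ratio. *)
Lemma good_position {R : realType} n (A e : R) (D : set 'rV[R]_n) :
  (0 < n)%N -> 0 < A -> 0 < e -> symmetric_convex_body D ->
  ((A^-1 * Num.sqrt n%:R)%:E <= volume_ratio D)%E ->
  exists N U : 'M[R]_n, [/\ N \in unitmx,
    forall y, sqnorm y <= 1 -> D (y *m N),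
    forall x, D x -> forall i, `|(x *m (invmx N *m U^T)) 0 i| <= 1 &
    n`!%:R / (n%:R * (1 + e)) ^+ n <= \det U ^+ 2].
Proof.
move=> n0 A0 e0 bD vr; have [cD kD _ sD] := bD.
have nR : 0 < n%:R :> R by rewrite ltr0n.
pose xi : R := n%:R * e; have xi0 : 0 < xi by rewrite mulr_gt0.
set del := dr_tau n xi * xi / 2.
have del0 : 0 < del by rewrite divr_gt0// mulr_gt0// dr_tau_gt0.
pose X := [set d | exists2 N : 'M[R]_n,
   (forall y, sqnorm y <= 1 -> D (y *m N)) & d = `|\det N|].
have [r r0 rD] := symmetric_body_contains_ball bD.
have rX : X (`|\det (r%:M : 'M[R]_n)|).
  by exists r%:M => // y y1; rewrite mul_mx_scalar; exact: rD.
have w0 : 0 < (A^-1 * Num.sqrt n%:R) ^+ n * ball_volume n :> R.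
  by rewrite mulr_gt0 ?ball_volume_gt0// exprn_gt0// mulr_gt0 ?invr_gt0// sqrtr_gt0.
have ubX d : X d -> d <= fine (volume D) / ((A^-1 * Num.sqrt n%:R) ^+ n * ball_volume n).
  move=> [N ND ->]; have [Nu|] := boolP (N \in unitmx).
    rewrite ler_pdivlMr// mulrC -mulrA.
    exact: volume_ratio_le ND vr.
  rewrite unitmxE unitfE negbK => /eqP ->; rewrite normr0 divr_ge0 ?(ltW w0)//.
  by rewrite fine_ge0 ?volume_ge0.
have supX : has_sup X.
  split; first by exists (`|\det (r%:M : 'M[R]_n)|).
  by exists (fine (volume D) / ((A^-1 * Num.sqrt n%:R) ^+ n * ball_volume n)).
have s0 : 0 < sup X.
  apply: lt_le_trans (sup_upper_bound supX rX).
  by rewrite det_scalar normr_gt0 expf_eq0 negb_and (gt_eqF r0) orbT.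
(* Stretching the ball multiplies its volume by at least k. *)
set k := Num.sqrt (1 + del).
have k1 : 1 < k by rewrite -[ltLHS]sqrtr1 ltr_sqrt; lra.
have k0 : 0 < k by lra.
have kk : k ^+ 2 = 1 + del by rewrite sqr_sqrtr//; lra.
have ek : 0 < sup X - sup X / k.
  by rewrite subr_gt0 ltr_pdivrMr// ltr_pMr.
have [_ [N ND ->]] := sup_adherent ek supX.
rewrite opprB addrC subrK ltr_pdivrMr// => Nsup.
have dN : 0 < `|\det N|.
  by rewrite -(pmulr_lgt0 _ k0); exact: lt_trans Nsup.
have Nu : N \in unitmx by rewrite unitmxE unitfE -normr_gt0.
pose D1 := [set y | D (y *m N)].
have max1 (S : 'M[R]_n) : (forall y, sqnorm y <= 1 -> D1 (y *m S)) ->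
    \det S ^+ 2 < 1 + del.
  move=> SD; rewrite -kk -[\det S ^+ 2]real_normK ?num_real//.
  rewrite ltr_pXn2r// ?nnegrE ?normr_ge0 ?(ltW k0)//.
  rewrite -(ltr_pM2r dN) -normrM -det_mulmx [ltRHS]mulrC.
  apply: le_lt_trans Nsup; apply: sup_upper_bound => //.
  by exists (S *m N) => // y y1; rewrite mulmxA; exact: SD.
have D0 : D 0.
  have := rD 0; rewrite scaler0; apply.
  by rewrite /sqnorm big1// => i _; rewrite mxE expr0n.
have sep1 x : ~ D1 x -> exists u, (forall d, D1 d -> dot u d <= 1) /\ 1 < dot u x.
  move=> Dx; have [|u [c [uD cx]]] := separation cD kD _ Dx; first by exists 0.
  have c0 : 0 <= c.
    by have := uD 0 D0; rewrite -(scale0r 0) dotZr mul0r.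
  pose b := (c + dot u (x *m N)) / 2.
  have cb : c < b by rewrite /b; lra.
  have b0 : 0 < b by lra.
  exists ((b^-1 *: u) *m N^T); split=> [d D1d|].
    rewrite dot_mulmx trmxK dotC dotZr mulrC ler_pdivrMr// mul1r dotC.
    by apply: le_trans (ltW cb); exact: uD.
  rewrite dot_mulmx trmxK dotC dotZr mulrC ltr_pdivlMr// mul1r dotC /b; lra.
have [U [UD1 Udet]] := dvoretzky_rogers n0 xi0 ND max1 sep1.
exists N, U; split=> // [x Dx i|]; last by rewrite mulrDr mulr1.
have coord z : D z -> (z *m (invmx N *m U^T)) 0 i <= 1.
  move=> Dz; have := UD1 i (z *m invmx N); rewrite /D1 /= mulmxKV// => /(_ Dz).
  rewrite mulmxA; congr (_ <= _); rewrite dotC /dot [RHS]mxE.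
  by apply: eq_bigr => j _; rewrite [row i U _ _]mxE [U^T _ _]mxE.
rewrite ler_norml coord// andbT lerNl.
by have := coord _ (sD _ Dx); rewrite mulNmx [X in X <= _]mxE.
Qed.

(** Compare the two bounds on the volume of [D]: from below by the ellipsoid
    [B N] and from above by the cover.  The determinant of [N] and the powers of
    [sqrt n] cancel.  The constants come from [cap_integral_ge] and from [e]. *)
Lemma cube_cover_bound {R : realType} n (A : R) (D : set 'rV[R]_n) :
  (0 < n)%N -> 0 < A -> symmetric_convex_body D ->
  ((A^-1 * Num.sqrt n%:R)%:E <= volume_ratio D)%E ->
  exists T : 'M[R]_n, [/\ T \in unitmx,
    forall x, D x -> forall i, `|(x *m T) 0 i| <= 1 &
    forall (J : finType) (z : J -> 'rV[R]_n) (s : R), 0 < s ->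
      (forall x, D x -> exists j, forall i, `|(x *m T - z j) 0 i| <= s) ->
      (103 / 100) ^+ n.-1 <= #|J|%:R * (s * (101 / 100 * A)) ^+ n].
Proof.
move=> n0 A0 bD vr; have [_ kD _ _] := bD.
pose e : R := 1 / 1000; have e0 : 0 < e by rewrite /e; lra.
have e1 : e < 1 by rewrite /e; lra.
have [N [U [Nu ND UD Udet]]] := good_position n0 A0 e0 bD vr.
have nR : 0 < n%:R :> R by rewrite ltr0n.
have fR : 0 < n`!%:R :> R by rewrite ltr0n fact_gt0.
have p0 : 0 < n%:R * (1 + e) :> R by rewrite mulr_gt0// addr_gt0.
have dU : 0 < `|\det U|.
  rewrite normr_gt0 -sqrf_eq0 gt_eqF//; apply: lt_le_trans Udet.
  by rewrite divr_gt0// exprn_gt0.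
have Uu : U^T \in unitmx by rewrite unitmx_tr unitmxE unitfE -normr_gt0.
have dN : 0 < `|\det N| by rewrite normr_gt0 -unitfE -unitmxE.
pose T := invmx N *m U^T; have Tu : T \in unitmx by rewrite unitmx_mul unitmx_inv Nu.
exists T; split=> // J z s s0 cov.
have Mu : invmx T \in unitmx by rewrite unitmx_inv.
have := @volume_le_cube_cover R n (invmx T) J z s e D n0 Mu s0 e0 e1.
rewrite invmxK => /(_ cov); rewrite -[volume D]fineK ?volume_fin// lee_fin => vol.
have := le_trans (volume_ratio_le n0 A0 Nu ND vr) vol.
have -> : `|\det (invmx T)| = `|\det N| / `|\det U|.
  rewrite det_inv det_mulmx det_inv det_tr normrV ?unitfE; last first.
    by rewrite mulf_neq0 ?invr_neq0// -normr_gt0.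
  rewrite normrM normrV ?unitfE -?normr_gt0//; field.
  by rewrite !gt_eqF.
set w := (1 + e) / (1 - e); set v := ball_volume n.
have w0 : 0 < w by apply: divr_gt0; lra.
set X := (A^-1 * _) ^+ n; move=> main.
have {}main : X * v * `|\det U| <= #|J|%:R * (2 * s * w) ^+ n.
  rewrite -(ler_pM2r (divr_gt0 dN dU)); apply: le_trans main.
  by rewrite le_eqVlt; apply/orP; left; apply/eqP; field; rewrite gt_eqF.
have sU : Num.sqrt n`!%:R <= `|\det U| * (Num.sqrt n%:R * (1 + e)) ^+ n.
  have r0 : 0 <= `|\det U| * (Num.sqrt n%:R * (1 + e)) ^+ n.
    by rewrite mulr_ge0// exprn_ge0// mulr_ge0 ?sqrtr_ge0//; lra.
  rewrite -(@ler_pXn2r _ 2)// ?nnegrE ?sqrtr_ge0//.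
  have E : ((Num.sqrt n%:R * (1 + e)) ^+ n) ^+ 2 = (n%:R * (1 + e) ^+ 2) ^+ n.
    by rewrite exprAC [(_ * (1 + e)) ^+ 2]exprMn (sqr_sqrtr (ltW nR)).
  rewrite (sqr_sqrtr (ltW fR)) exprMn E real_normK ?num_real//.
  move: Udet; rewrite ler_pdivrMr ?exprn_gt0// => Udet.
  apply: le_trans Udet _; rewrite ler_wpM2l ?sqr_ge0// lerXn2r ?nnegrE//.
  - by rewrite ltW.
  - by rewrite mulr_ge0 ?sqr_ge0// ltW.
  - by rewrite ler_wpM2l ?(ltW nR)// /e; lra.
have q0 : 0 < Num.sqrt n%:R :> R by rewrite sqrtr_gt0.
have v0 : 0 < v := ball_volume_gt0 n.
have vU : 2 ^+ n * (103 / 100) ^+ n.-1 <=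
    #|J|%:R * (2 * (s * (101 / 100 * A))) ^+ n.
  have := @ball_volume_ge R n.-1; rewrite prednK// -/v => /le_trans; apply.
  apply: le_trans (ler_wpM2l (ltW v0) sU) _.
  have -> : v * (`|\det U| * (Num.sqrt n%:R * (1 + e)) ^+ n) =
      X * v * `|\det U| * ((1 + e) * A) ^+ n.
    rewrite /X !exprMn exprVn; field.
    by rewrite gt_eqF// exprn_gt0.
  apply: le_trans (ler_wpM2r _ main) _.
    by rewrite exprn_ge0// mulr_ge0 ?addr_ge0 ?ltW.
  rewrite -[leLHS]mulrA -exprMn ler_wpM2l// lerXn2r ?nnegrE//.
  - apply: mulr_ge0; apply: mulr_ge0; [|exact: ltW| |exact: ltW].
      by apply: mulr_ge0; [|exact: ltW].
    by rewrite addr_ge0// ltW.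
  - by rewrite !mulr_ge0 ?(ltW s0) ?(ltW A0)//; lra.
  - have we : w * (1 + e) <= 101 / 100.
      rewrite /w mulrAC ler_pdivrMr ?subr_gt0// /e; lra.
    have sA : 0 <= 2 * s * A by rewrite !mulr_ge0 ?ltW.
    have := ler_wpM2l sA we; rewrite /w; lra.
by move: vU; rewrite [(2 * (s * _)) ^+ n]exprMn [leRHS]mulrCA ler_pM2l // exprn_gt0.
Qed.

(** * The cube in a coordinate projection *)

(** One cube of half-side 1 covers the image of [D].  Since [n - 1 >= n / 2], the
    cover bound gives [103 / 100 <= (101 / 100 * A) ^ 2]. *)
Lemma volume_ratio_constant_ge {R : realType} n (A : R) (D : set 'rV[R]_n) :
  (1 < n)%N -> 0 < A -> symmetric_convex_body D ->
  ((A^-1 * Num.sqrt n%:R)%:E <= volume_ratio D)%E -> 1004 / 1000 <= A.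
Proof.
move=> n1 A0 bD vr; have n0 := ltnW n1.
have [T [_ TD cov]] := cube_cover_bound n0 A0 bD vr.
have := cov unit (fun=> 0) 1 ltr01; rewrite card_unit !mul1r => H.
have {}H : (103 / 100) ^+ n.-1 <= (101 / 100 * A) ^+ n.
  by apply: H => x Dx; exists tt => i; rewrite subr0; exact: TD.
rewrite leNgt; apply/negP => A1.
pose t := 101 / 100 * A; have t0 : 0 <= t by rewrite /t; lra.
have t2 : t ^+ 2 < 103 / 100 by rewrite /t; nra.
have : t ^+ n ^+ 2 < (103 / 100) ^+ n.
  by rewrite exprAC ltrXn2r// ?gtn_eqF// ?sqr_ge0//; lra.
apply/negP; rewrite -leNgt.
apply: (@le_trans _ _ (((103 / 100) ^+ n.-1) ^+ 2)).
  rewrite -exprM ler_weXn2l//; first by lra.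
  by lia.
by rewrite lerXn2r ?nnegrE ?exprn_ge0//; lra.
Qed.

Lemma convex_set_mulmx {R : realType} n k (F : 'M[R]_(n, k)) (D : set 'rV[R]_n) :
  convex_set D -> convex_set [set x *m F | x in D].
Proof.
move=> cD _ _ l /set_mem[x Dx <-] /set_mem[y Dy <-].
apply/mem_set; exists (l%:num *: x + (1 - l%:num) *: y).
  by have := cD x y l (mem_set Dx) (mem_set Dy); rewrite inE.
by rewrite mulmxDl -!scalemxAl.
Qed.

(** The grid cells of side [2 / q] that meet the image of [D] cover it, so there
    are at least [8 ^ n] of them, and the cells play the role of words over [q]
    letters.  A free letter between two cells is a gap of width [2 / q] between
    points of the image, and the centre of the cube is in its middle. *)
Lemma coordinate_projection_contains_cube {R : realType} n q
    (D : set 'rV[R]_n) (T : 'M[R]_n) :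
  (0 < q)%N -> symmetric_convex_body D ->
  (forall x, D x -> forall i, `|(x *m T) 0 i| <= 1) ->
  (forall (J : finType) (z : J -> 'rV[R]_n),
     (forall x, D x -> exists j, forall i, `|(x *m T - z j) 0 i| <= q%:R^-1) ->
     (8 ^ n <= #|J|)%N) ->
  exists k (f : 'I_k -> 'I_n), [/\ injective f, (2 ^ n <= q ^ k)%N &
    forall y : 'rV[R]_k, (forall j, `|y 0 j| <= q%:R^-1) ->
      exists2 x, D x & x *m colsub f T = y].
Proof.
move=> q0 [cD kD _ sD] TD many.
have qR : 0 < q%:R :> R by rewrite ltr0n.
pose meets (c : {ffun 'I_n -> 'I_q}) := `[< exists2 x, D x & forall i,
  2 * (c i)%:R <= q%:R * ((x *m T) 0 i + 1) <= 2 * (c i).+1%:R >].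
have cells : (8 ^ n <= #|[set c | meets c]%SET|)%N.
  rewrite -card_sig.
  apply: (many _ (fun c : {c | c \in [set c | meets c]%SET} =>
    \row_i ((2 * (val c i)%:R + 1) / q%:R - 1))) => x Dx.
  pose t i := q%:R * ((x *m T) 0 i + 1) / 2.
  have t0 i : 0 <= t i.
    rewrite /t; have := TD _ Dx i; rewrite ler_norml => /andP[h _].
    by rewrite divr_ge0// mulr_ge0 ?(ltW qR)//; lra.
  have tq i : t i <= q%:R.
    rewrite /t; have := TD _ Dx i; rewrite ler_norml => /andP[_ h].
    by rewrite ler_pdivrMr// ler_pM2l//; lra.
  have mq i : (minn (Num.truncn (t i)) q.-1 < q)%N.
    by rewrite (leq_ltn_trans (geq_minr _ _))// ltn_predL.
  pose c : {ffun 'I_n -> 'I_q} := [ffun i => Ordinal (mq i)].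
  have ct i : (c i)%:R <= t i <= (c i).+1%:R.
    rewrite ffunE /=; have /andP[h1 h2] := Num.Theory.truncn_itv (t0 i).
    rewrite /minn; case: ltnP => h3; first by rewrite h1 ltW.
    rewrite prednK// tq andbT; apply: le_trans h1.
    by rewrite ler_nat.
  have cP : c \in [set c | meets c]%SET.
    rewrite inE; apply/asboolP; exists x => // i.
    by have := ct i; rewrite /t ler_pdivlMr// ler_pdivrMr// ![_ * 2]mulrC.
  have subE (z : 'rV[R]_n) i : (x *m T - z) 0 i = (x *m T) 0 i - z 0 i.
    by rewrite mxE [X in _ + X]mxE.
  exists (Sub c cP) => i; rewrite subE [X in _ - X]mxE SubK.
  have := ct i; rewrite /t -[(c i).+1%:R]natr1.
  set u := (x *m T) 0 i; set d := (c i)%:R => /andP[h1 h2].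
  rewrite -(ler_pM2l qR) mulfV ?gt_eqF// -[X in X * `|_|](gtr0_norm qR) -normrM.
  have -> : q%:R * (u - ((2 * d + 1) / q%:R - 1)) = q%:R * (u + 1) - 2 * d - 1.
    by field; rewrite gt_eqF.
  by rewrite ler_norml; apply/andP; split; lra.
have [I [m [Iq Ish]]] := gap_shattering cells.
pose f : 'I_#|I| -> 'I_n := enum_val.
have fI j : f j \in I by exact: enum_valP.
exists #|I|, f; split=> //; first exact: enum_val_inj.
set F := colsub f T.
have FE x j : (x *m F) 0 j = (x *m T) 0 (f j).
  by rewrite !mxE; apply: eq_bigr => i _; rewrite mxE.
pose V := [set x *m F | x in D].
have cV : convex_set V by exact: convex_set_mulmx.
have kV : compact V.
  apply: continuous_compact => //; apply: continuous_subspaceT.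
  exact: continuous_mulmxr.
have sV y : V y -> V (- y).
  by move=> [x Dx <-]; exists (- x); rewrite ?mulNmx//; exact: sD.
have g0 : 0 <= q%:R^-1 :> R by rewrite invr_ge0 ltW.
(* The middle of the free letter m (f j). *)
pose ctr : 'rV[R]_#|I| := \row_j ((2 * (m (f j))%:R + 1) / q%:R - 1).
move=> y yq; suff [x Dx xy] : V y by exists x.
apply: (@symmetric_orthants_cover_cube R _ V ctr _ cV kV sV g0) => // e.
have [c + cI] := Ish (fun i => [exists j, (f j == i) && e j]).
rewrite inE => /asboolP[x Dx xc]; exists (x *m F); first by exists x.
move=> j; rewrite FE [ctr 0 j]mxE.
have -> : e j = [exists j', (f j' == f j) && e j'].
  apply/idP/existsP => [ej|[j' /andP[/eqP/enum_val_inj -> //]]].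
  by exists j; rewrite eqxx.
have /andP[h1 h2] := xc (f j); have := cI _ (fI j).
set u := (x *m T) 0 (f j) in h1 h2 *; case: [exists j', _] => h.
- rewrite -(ler_pM2l qR).
  have -> : q%:R * ((2 * (m (f j))%:R + 1) / q%:R - 1 + q%:R^-1) =
      2 * (m (f j))%:R + 2 - q%:R :> R.
    by field; rewrite gt_eqF.
  have : (m (f j)).+1%:R <= (c (f j))%:R :> R by rewrite ler_nat.
  rewrite -[(m (f j)).+1%:R]natr1; lra.
- rewrite -(ler_pM2l qR).
  have -> : q%:R * ((2 * (m (f j))%:R + 1) / q%:R - 1 - q%:R^-1) =
      2 * (m (f j))%:R - q%:R :> R.
    by field; rewrite gt_eqF.
  have : (c (f j)).+1%:R <= (m (f j))%:R :> R by rewrite ler_nat.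
  by lra.
Qed.

(** * The Banach-Mazur distance *)

(** [P = F G] is a projection because [G F = 1], and [F] identifies its image
    with the coordinate space. *)
Lemma banach_mazur_cube_le {R : realType} n k (D : set 'rV[R]_n)
    (F : 'M[R]_(n, k)) (G : 'M[R]_(k, n)) (d : R) :
  0 < d -> G *m F = 1%:M ->
  (forall x, D x -> forall j, `|(x *m F) 0 j| <= 1) ->
  (forall y : 'rV[R]_k, (forall j, `|y 0 j| <= d^-1) ->
     exists2 x, D x & x *m F = y) ->
  exists P : 'End('rV[R]_n), [/\ (P \o P)%VF = P, \dim (limg P) = k &
    (banach_mazur (projected_body P D) (cube R k) <= d%:E)%E].
Proof.
move=> d0 GF DF cubeF.
pose P : 'End('rV[R]_n) := linfun (mulmxr (F *m G)).
have PE x : P x = x *m F *m G by rewrite lfunE /= mulmxA.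
exists P; split.
- apply/lfunP => x; rewrite comp_lfunE !PE -!mulmxA; congr (_ *m _).
  by rewrite !mulmxA -[F *m G *m F]mulmxA GF mulmx1.
- pose Gl : 'Hom('rV[R]_k, 'rV[R]_n) := linfun (mulmxr G).
  have -> : limg P = limg Gl.
    apply/vspaceP => v; apply/memv_imgP/memv_imgP => -[u _ ->].
      by exists (u *m F); rewrite ?memvf// PE lfunE.
    by exists (u *m G); rewrite ?memvf// PE lfunE /= -[u *m G *m F]mulmxA GF mulmx1.
  rewrite limg_dim_eq ?dimvf /dim /= ?mul1n//.
  apply/eqP; rewrite -subv0; apply/subvP => v /memv_capP[_].
  rewrite memv_ker lfunE /= => /eqP vG.
  by rewrite memv0 -[v]mulmx1 -GF mulmxA vG mul0mx.
pose Tl : 'Hom(subvs_of (limg P), 'rV[R]_k) :=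
  linfun (mulmxr F \o (vsval : subvs_of (limg P) -> 'rV[R]_n)).
have TE v : Tl v = vsval v *m F by rewrite lfunE.
have PF x : P x *m F = x *m F by rewrite PE -mulmxA GF mulmx1.
apply: ereal_inf_lbound; exists d, 1, Tl; split=> //.
- split.
    apply/eqP; rewrite -subv0; apply/subvP => v.
    rewrite memv_ker TE memv0 => /eqP vF; apply/eqP/val_inj => /=.
    have /memv_imgP[u _ uv] := subvsP v.
    by rewrite uv PE -PF -uv vF mul0mx.
  apply/vspaceP => y; rewrite memvf; apply/memv_imgP.
  exists (vsproj (limg P) (y *m G)); rewrite ?memvf// TE vsprojK.
    by rewrite -mulmxA GF mulmx1.
  by apply/memv_imgP; exists (y *m G); rewrite ?memvf// PE -[y *m G *m F]mulmxA GF mulmx1.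
- move=> _ [y yc <-].
  have [|x Dx xy] := cubeF (d^-1 *: y).
    move=> j; rewrite mxE normrM gtr0_norm ?invr_gt0// ler_piMr ?invr_ge0 ?(ltW d0)//.
  exists (vsproj (limg P) (P x)).
    by rewrite /projected_body /= vsprojK ?memv_img ?memvf//; exists x.
  by rewrite TE vsprojK ?memv_img ?memvf// PF.
- move=> _ [v [x Dx xv] <-]; exists (Tl v); last by rewrite scale1r.
  by move=> j; rewrite TE -xv PF; exact: DF.
- by rewrite mulr1.
Qed.

Unset Implicit Arguments.
Set Strict Implicit.
Set Printing Implicit Defensive.

(* The hypothesis (1 < n) \/ (2 <= A) excludes only n = 1 with A < 2. There
   every D has volume ratio 1, so all A >= 1 satisfy the volume bound while
   ln A may be arbitrarily small and the rank bound k >= c / ln A impossible.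
   For n > 1 the volume bound itself keeps A away from 1. *)
Theorem theorem2p1 (R : realType) :
  exists C c : R, [/\ 0 < C, 0 < c &
    forall (n : nat) (A : R) (D : set 'rV[R]_n),
      (0 < n)%N -> 0 < A -> (1 < n)%N \/ 2 <= A ->
      symmetric_convex_body D ->
      ((A^-1 * Num.sqrt n%:R)%:E <= volume_ratio D)%E ->
      exists (k : nat) (P : 'End('rV[R]_n)),
        [/\ (P \o P)%VF = P,
            \dim (limg P) = k,
            c * (n%:R / ln A) <= k%:R
          & (banach_mazur (projected_body P D) (cube R k) <= (C * A)%:E)%E]].
Proof.
pose a0 : R := 1004 / 1000.
have a01 : 1 < a0 by rewrite /a0; lra.
have la0 : 0 < ln a0 by rewrite ln_gt0.
have l10 : 0 < ln 10 :> R by rewrite ln_gt0//; lra.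
have l2 : 0 < ln 2 :> R by rewrite ln_gt0//; lra.
(* ln (10 A) <= B ln A as soon as A >= a0. *)
pose B := 1 + ln 10 / ln a0.
have B0 : 0 < B by rewrite addr_gt0// divr_gt0.
exists 10, (ln 2 / B); split=> [||n A D n0 A0 nA bD vr]; [by []|by rewrite divr_gt0|].
have a0A : a0 <= A.
  case: nA => [n1|A2]; first exact: volume_ratio_constant_ge n1 A0 bD vr.
  by rewrite /a0; lra.
have A1 : 1 < A by exact: lt_le_trans a0A.
have lA : ln a0 <= ln A by rewrite ler_ln ?posrE//; lra.
have lA0 : 0 < ln A by exact: lt_le_trans lA.
have [T [Tu TD cov]] := cube_cover_bound n0 A0 bD vr.
(* The constant is such that (q / (1.01 A)) ^ n >= 8 ^ n. *)
pose q := (Num.truncn (9 * A)).+1.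
have q9 : 9 * A < q%:R by exact: Num.Theory.truncnS_gt.
have q10 : q%:R <= 10 * A.
  have A90 : 0 <= 9 * A by lra.
  have /andP[h _] := Num.Theory.truncn_itv A90.
  by rewrite /q -natr1; lra.
have qR : 0 < q%:R :> R by rewrite ltr0n.
have [J z JD|k [f [f_inj kq cubeD]]] :=
    coordinate_projection_contains_cube (ltn0Sn _ : (0 < q)%N) bD TD.
  have qV : 0 < q%:R^-1 :> R by rewrite invr_gt0.
  have := cov J z _ qV JD; rewrite -(ler_nat R) natrX => le_J.
  pose t : R := q%:R^-1 * (101 / 100 * A).
  have t0 : 0 < t by rewrite mulr_gt0//; lra.
  have t8 : 8 * t <= 1.
    by rewrite /t mulrCA mulrC ler_pdivrMr// mul1r; lra.
  have le1 : 1 <= #|J|%:R * t ^+ n.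
    apply: le_trans le_J; rewrite exprn_ege1//; lra.
  rewrite -(ler_pM2r (exprn_gt0 n t0)) -exprMn; apply: le_trans le1.
  by rewrite exprn_ile1// mulr_ge0 ?(ltW t0).
pose F := colsub f T; pose G := rowsub f (invmx T).
have GF : G *m F = 1%:M.
  rewrite /G /F; apply/matrixP => i j; rewrite mxE.
  have := congr1 (fun X : 'M[R]_n => X (f i) (f j)) (mulVmx Tu).
  rewrite /= !mxE (inj_eq f_inj) => <-.
  by apply: eq_bigr => l _; rewrite !mxE.
have DF x : D x -> forall j, `|(x *m F) 0 j| <= 1.
  move=> Dx j; have := TD _ Dx (f j); congr (`|_| <= _).
  by rewrite !mxE; apply: eq_bigr => i _; rewrite mxE.
have [P [PP dimP dP]] := banach_mazur_cube_le qR GF DF cubeD.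
exists k, P; split=> //; last by apply: le_trans dP _; rewrite lee_fin.
have klq : n%:R * ln 2 <= k%:R * ln q%:R :> R.
  rewrite !mulr_natl -!lnXn// -!natrX ler_ln ?posrE ?ltr0n ?expn_gt0//.
  by rewrite ler_nat.
have lq : ln q%:R <= B * ln A.
  apply: (@le_trans _ _ (ln (10 * A))).
    by rewrite ler_ln ?posrE//; lra.
  rewrite lnM ?posrE// /B mulrDl mul1r addrC lerD2l.
  by rewrite mulrAC ler_pdivlMr// ler_pM2l.
rewrite mulrA ler_pdivrMr// mulrAC ler_pdivrMr// mulrC.
apply: le_trans klq _; rewrite -mulrA [ln A * B]mulrC.
exact: ler_wpM2l.
Qed.
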